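(* Let $\epsilon\in\{0,\tfrac12\}$, let $c\in\mathbb{C}$, and let $\psi:\mathfrak{p}_\epsilon\to\mathbb{C}$ be a nontrivial (i.e. nonzero) Lie superalgebra homomorphism. Then: (i) if $\epsilon=\tfrac12$, the $\mathrm{SVir}_{\frac12}$-module $W_{\frac12}(\psi,c)$ is simple; (ii) if $\epsilon=0$, the $\mathrm{SVir}_0$-module $W_0(\psi,c)$ is simple if and only if $\psi(L_2)\neq 0$.
   Context: Everything is over $\mathbb{C}$. For $\epsilon\in\{0,\frac12\}$, $\mathrm{SVir}_\epsilon$ is the Lie superalgebra with even basis $\{L_m: m\in\mathbb{Z}\}\cup\{C\}$ and odd basis $\{G_r: r\in\mathbb{Z}+\epsilon\}$ and brackets, for $m,n\in\mathbb{Z}$, $r,s\in\mathbb{Z}+\epsilon$: $[L_m,L_n]=(m-n)L_{m+n}+\delta_{m,-n}\frac{m^3-m}{12}C$, $[L_m,G_r]=(\frac m2-r)G_{m+r}$, $[G_r,G_s]=2L_{r+s}+\frac13\delta_{r+s,0}(r^2-\frac14)C$, $[\mathrm{SVir}_\epsilon,C]=0$. $\mathfrak{p}_\epsilon$ is the subalgebra $\bigoplus_{n\ge1}\mathbb{C}L_n\oplus\bigoplus_{n\ge2}\mathbb{C}G_{n-\epsilon}$. A Lie superalgebra homomorphism $\psi:\mathfrak{p}_\epsilon\to\mathbb{C}$ is a parity-preserving homomorphism to the purely even abelian Lie algebra $\mathbb{C}$. Let $\mathbb{C}w_\psi$ be the one-dimensional module over $\mathfrak{p}_\epsilon\oplus\mathbb{C}C$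 with $xw_\psi=\psi(x)w_\psi$ for $x\in\mathfrak{p}_\epsilon$ and $Cw_\psi=cw_\psi$ (with $w_\psi$ homogeneous, say even). Define $W_\epsilon(\psi,c)=U(\mathrm{SVir}_\epsilon)\otimes_{U(\mathfrak{p}_\epsilon\oplus\mathbb{C}C)}\mathbb{C}w_\psi$. All modules over Lie superalgebras are $\mathbb{Z}_2$-graded, with action compatible with the grading; submodules are graded submodules, and simple means having no graded submodules other than $0$ and the whole (nonzero) module. *)

(* Defs.v *)
From HB Require Import structures.
From mathcomp Require Import all_boot all_order all_algebra.
From mathcomp Require Import boolp reals complex finmap monalg ring zify.

Set Implicit Arguments.
Unset Strict Implicit.
Unset Printing Implicit Defensive.

Import Order.TTheory GRing.Theory Num.Theory.

Local Open Scope ring_scope.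
Local Open Scope quotient_scope.

Section SuperLinearAlgebra.
Variable K : numFieldType.

(* A decomposition V = V_0 (+) V_1 is given by its two component maps;
   false is the even degree, true the odd one. *)
Record superspace := Superspace {
  super_sort :> lmodType K;
  component : bool -> super_sort -> super_sort;
  component_linear : forall p, linear (component p);
  component_sum : forall v, component false v + component true v = v;
  componentK : forall p q v,
    component p (component q v) = if p == q then component q v else 0 }.

HB.instance Definition _ (V : superspace) (p : bool) :=
  GRing.isLinear.Build K V V *:%R (@component V p) (@component_linear V p).

Definition homog (V : superspace) (p : bool) : {pred V} :=
  [pred v | component p v == v].
Arguments homog {V} p.

(* K has characteristic 0, so no extra axioms for odd squares and cubes are
   needed. *)
Record lieSuperalgebra := LieSuperalgebra {
  lie_super :> superspace;
  bracket : lie_super -> lie_super -> lie_super;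
  bracket_linearl : forall y, linear (bracket^~ y);
  bracket_linearr : forall x, linear (bracket x);
  bracket_homog : forall p q x y, x \in homog p ->
    y \in homog q -> bracket x y \in homog (p (+) q);
  bracket_skew : forall p q x y, x \in homog p ->
    y \in homog q ->
    bracket x y = - ((-1) ^+ (p && q) *: bracket y x);
  bracket_jacobi : forall p q x y z, x \in homog p ->
    y \in homog q ->
    bracket x (bracket y z) =
      bracket (bracket x y) z + (-1) ^+ (p && q) *: bracket y (bracket x z) }.

Record lieHom (g h : lieSuperalgebra) := LieHom {
  lie_fun :> g -> h;
  lie_fun_linear : linear lie_fun;
  lie_fun_component : forall p x,
    lie_fun (component p x) = component p (lie_fun x);
  lie_fun_bracket : forall x y,
    lie_fun (bracket x y) = bracket (lie_fun x) (lie_fun y) }.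

HB.instance Definition _ (g h : lieSuperalgebra) (f : lieHom g h) :=
  GRing.isLinear.Build K g h *:%R (lie_fun f) (lie_fun_linear f).

Record lieModule (g : lieSuperalgebra) := LieModule {
  mod_super :> superspace;
  action : g -> mod_super -> mod_super;
  action_linearl : forall v, linear (action^~ v);
  action_linearr : forall x, linear (action x);
  action_homog : forall p q x v, x \in homog p -> v \in homog q ->
    action x v \in homog (p (+) q);
  action_bracket : forall p q x y v, x \in homog p ->
    y \in homog q ->
    action (bracket x y) v =
      action x (action y v) - (-1) ^+ (p && q) *: action y (action x v) }.

Definition graded_submodule (g : lieSuperalgebra) (V : lieModule g)
    (N : {pred V}) : Prop :=
  [/\ GRing.submod_closed N,
      forall p v, v \in N -> component p v \in N
    & forall x v, v \in N -> action x v \in N].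

Definition simple_module (g : lieSuperalgebra) (V : lieModule g) : Prop :=
  (exists v : V, v != 0) /\
  forall N : {pred V}, graded_submodule N ->
    (forall v, v \in N -> v = 0) \/ (forall v, v \in N).

Record lieSub (g : lieSuperalgebra) := LieSub {
  lie_sub_mem :> {pred g};
  lie_sub_submod : GRing.submod_closed lie_sub_mem;
  lie_sub_component : forall p x,
    x \in lie_sub_mem -> component p x \in lie_sub_mem;
  lie_sub_bracket : forall x y, x \in lie_sub_mem -> y \in lie_sub_mem ->
    bracket x y \in lie_sub_mem }.

End SuperLinearAlgebra.

Arguments homog {K V} p.

Section SuperTheory.
Variable K : numFieldType.

Lemma homog_component (V : superspace K) p (v : V) : component p v \in homog p.
Proof. by rewrite inE componentK eqxx. Qed.

Lemma homogE (V : superspace K) p q (v : V) :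
  v \in homog q -> component p v = if p == q then v else 0.
Proof. by rewrite inE => /eqP <-; rewrite componentK. Qed.

Lemma component_sumE (V : superspace K) (v : V) :
  v = component false v + component true v.
Proof. by rewrite component_sum. Qed.

Section HomogSub.
Variables (V : superspace K) (p : bool).

Lemma homog0 : (0 : V) \in homog p. Proof. by rewrite inE linear0. Qed.

Lemma homogD (u v : V) : u \in homog p -> v \in homog p -> u + v \in homog p.
Proof. by rewrite !inE => /eqP hu /eqP hv; rewrite linearD /= hu hv. Qed.

Lemma homogZ a (v : V) : v \in homog p -> a *: v \in homog p.
Proof. by rewrite !inE => /eqP hv; rewrite linearZ /= hv. Qed.

Lemma homogN (v : V) : v \in homog p -> - v \in homog p.
Proof. by rewrite -scaleN1r; exact: homogZ. Qed.

End HomogSub.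

Section BracketLinear.
Variable g : lieSuperalgebra K.
Implicit Types x y z : g.

Definition bracketl y x := bracket x y.
HB.instance Definition _ y :=
  GRing.isLinear.Build K g g *:%R (bracketl y) (bracket_linearl y).
HB.instance Definition _ x :=
  GRing.isLinear.Build K g g *:%R (bracket x) (bracket_linearr x).

Lemma bracketDl x y z : bracket (x + y) z = bracket x z + bracket y z.
Proof. exact: (linearD (bracketl z)). Qed.
Lemma bracketZl a x z : bracket (a *: x) z = a *: bracket x z.
Proof. exact: (linearZZ (bracketl z)). Qed.
Lemma bracket0l z : bracket 0 z = 0.
Proof. exact: (linear0 (bracketl z)). Qed.

Lemma component_bracket p x y :
  component p (bracket x y) =
    bracket (component false x) (component p y) +
    bracket (component true x) (component (~~ p) y).
Proof.
rewrite {1}(component_sumE x) {1}(component_sumE y) bracketDl !linearD /=.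
have H q r : component p (bracket (component q x) (component r y)) =
  if p == q (+) r then bracket (component q x) (component r y) else 0.
  by apply/homogE/bracket_homog; exact: homog_component.
by rewrite !H; case: p {H}; rewrite /= ?addr0 ?add0r.
Qed.

End BracketLinear.

Section ActionLinear.
Variables (g : lieSuperalgebra K) (M : lieModule g).
Implicit Types (x y : g) (u v : M).

Definition actionl v x := action x v.
HB.instance Definition _ v :=
  GRing.isLinear.Build K g M *:%R (actionl v) (action_linearl v).
HB.instance Definition _ x :=
  GRing.isLinear.Build K M M *:%R (action x) (action_linearr x).

Lemma actionDl x y v : action (x + y) v = action x v + action y v.
Proof. exact: (linearD (actionl v)). Qed.
Lemma actionZl a x v : action (a *: x) v = a *: action x v.
Proof. exact: (linearZZ (actionl v)). Qed.

Lemma component_action p x v :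
  component p (action x v) =
    action (component false x) (component p v) +
    action (component true x) (component (~~ p) v).
Proof.
rewrite {1}(component_sumE x) {1}(component_sumE v) actionDl !linearD /=.
have H q r : component p (action (component q x) (component r v)) =
  if p == q (+) r then action (component q x) (component r v) else 0.
  by apply/homogE/action_homog; exact: homog_component.
by rewrite !H; case: p {H}; rewrite /= ?addr0 ?add0r.
Qed.

End ActionLinear.

Section SubLie.
Variables (g : lieSuperalgebra K) (S : lieSub g).

Definition sub_lie := {x : g | x \in S}.
HB.instance Definition _ := [isSub of sub_lie for @sval _ _].
HB.instance Definition _ := [Choice of sub_lie by <:].
HB.instance Definition _ :=
  GRing.SubChoice_isSubLmodule.Build K g _ sub_lie
    (GRing.submod_closed_semi (lie_sub_submod S)).

Definition sub_component p (x : sub_lie) : sub_lie :=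
  Sub (component p (val x)) (lie_sub_component p (valP x)).

Fact sub_component_linear p : linear (sub_component p).
Proof. by move=> a x y; apply: val_inj; rewrite /= linearP. Qed.
Fact sub_component_sum x : sub_component false x + sub_component true x = x.
Proof. by apply: val_inj; rewrite /= component_sum. Qed.
Fact sub_componentK p q x :
  sub_component p (sub_component q x) = if p == q then sub_component q x else 0.
Proof. by apply: val_inj; rewrite /= componentK; case: ifP. Qed.

Definition sub_super : superspace K :=
  Superspace sub_component_linear sub_component_sum sub_componentK.

Lemma sub_homog p (x : sub_super) : (x \in homog p) = (val x \in homog p).
Proof. by rewrite !inE -val_eqE. Qed.

Definition sub_bracket (x y : sub_super) : sub_super :=
  Sub (bracket (val x) (val y)) (lie_sub_bracket (valP x) (valP y)).

Fact sub_bracket_linearl y : linear (sub_bracket^~ y).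
Proof. by move=> a x z; apply: val_inj; rewrite /= bracketDl bracketZl. Qed.
Fact sub_bracket_linearr x : linear (sub_bracket x).
Proof. by move=> a y z; apply: val_inj; rewrite /= linearP. Qed.
Fact sub_bracket_homog p q (x y : sub_super) : x \in homog p ->
    y \in homog q ->
  sub_bracket x y \in homog (p (+) q).
Proof. by rewrite !sub_homog; exact: bracket_homog. Qed.
Fact sub_bracket_skew p q (x y : sub_super) : x \in homog p ->
    y \in homog q ->
  sub_bracket x y = - ((-1) ^+ (p && q) *: sub_bracket y x).
Proof.
by rewrite !sub_homog => hx hy; apply: val_inj; rewrite /= (bracket_skew hx hy).
Qed.
Fact sub_bracket_jacobi p q (x y z : sub_super) :
  x \in homog p -> y \in homog q ->
  sub_bracket x (sub_bracket y z) = sub_bracket (sub_bracket x y) z +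
    (-1) ^+ (p && q) *: sub_bracket y (sub_bracket x z).
Proof.
rewrite !sub_homog => hx hy; apply: val_inj.
by rewrite /= (bracket_jacobi _ hx hy).
Qed.

Definition subLie : lieSuperalgebra K :=
  LieSuperalgebra sub_bracket_linearl sub_bracket_linearr sub_bracket_homog
    sub_bracket_skew sub_bracket_jacobi.

End SubLie.

Section Line.

Definition line_component (p : bool) (v : K^o) : K^o := if p then 0 else v.

Fact line_component_linear p : linear (line_component p).
Proof. by case: p => a u v //=; rewrite /line_component scaler0 addr0. Qed.
Fact line_component_sum v : line_component false v + line_component true v = v.
Proof. exact: addr0. Qed.
Fact line_componentK p q v : line_component p (line_component q v) =
  if p == q then line_component q v else 0.
Proof. by case: p; case: q. Qed.

Definition line_super : superspace K :=
  Superspace line_component_linear line_component_sum line_componentK.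

Definition line_bracket (x y : line_super) : line_super := 0.

Fact line_bracket_linearl y : linear (line_bracket^~ y).
Proof. by move=> a u v; rewrite scaler0 addr0. Qed.
Fact line_bracket_linearr x : linear (line_bracket x).
Proof. by move=> a u v; rewrite scaler0 addr0. Qed.
Fact line_bracket_homog p q (x y : line_super) : x \in homog p ->
    y \in homog q ->
  line_bracket x y \in homog (p (+) q).
Proof. by move=> _ _; exact: homog0. Qed.
Fact line_bracket_skew p q (x y : line_super) : x \in homog p ->
    y \in homog q ->
  line_bracket x y = - ((-1) ^+ (p && q) *: line_bracket y x).
Proof. by move=> _ _; rewrite scaler0 oppr0. Qed.
Fact line_bracket_jacobi p q (x y z : line_super) :
  x \in homog p -> y \in homog q ->
  line_bracket x (line_bracket y z) = line_bracket (line_bracket x y) z +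
    (-1) ^+ (p && q) *: line_bracket y (line_bracket x z).
Proof. by move=> _ _; rewrite scaler0 addr0. Qed.

(* The field K as a purely even abelian Lie superalgebra. *)
Definition lineLie : lieSuperalgebra K :=
  LieSuperalgebra line_bracket_linearl line_bracket_linearr line_bracket_homog
    line_bracket_skew line_bracket_jacobi.

Variables (g : lieSuperalgebra K) (chi : lieHom g lineLie).

Definition line_action (x : g) (v : line_super) : line_super :=
  (chi x : K) *: v.

Fact line_action_linearl v : linear (line_action^~ v).
Proof. by move=> a x y; rewrite /line_action linearP scalerDl -scalerA. Qed.
Fact line_action_linearr x : linear (line_action x).
Proof.
by move=> a u v; rewrite /line_action scalerDr !scalerA [a * _]mulrC.
Qed.
Fact line_action_homog p q x (v : line_super) : x \in homog p -> v \in homog q ->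
  line_action x v \in homog (p (+) q).
Proof.
move=> hx hv; have: chi x \in homog p.
  by move: hx; rewrite !inE -lie_fun_component => /eqP ->.
rewrite /line_action; case: p {hx} => [|_]; last exact: homogZ.
by rewrite inE => /eqP <-; rewrite [component _ _]/= scale0r homog0.
Qed.
Fact line_action_bracket p q x y v : x \in homog p ->
    y \in homog q ->
  line_action (bracket x y) v = line_action x (line_action y v) -
    (-1) ^+ (p && q) *: line_action y (line_action x v).
Proof.
move=> hx hy; rewrite /line_action lie_fun_bracket scale0r.
have: chi x \in homog p by move: hx; rewrite !inE -lie_fun_component => /eqP ->.
case: p {hx} => [|_]; last by rewrite expr0 scale1r !scalerA mulrC subrr.
rewrite inE => /eqP <-; rewrite [component _ _]/=.
by rewrite !scale0r !scaler0 subr0.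
Qed.

Definition lineModule : lieModule g :=
  LieModule line_action_linearl line_action_linearr line_action_homog
    line_action_bracket.

End Line.

Section SumLie.
Variables g h : lieSuperalgebra K.

Definition sum_component (p : bool) (x : g * h) : g * h :=
  (component p x.1, component p x.2).

Fact sum_component_linear p : linear (sum_component p).
Proof. by move=> a x y; rewrite /sum_component /= !linearP. Qed.
Fact sum_component_sum x : sum_component false x + sum_component true x = x.
Proof. by case: x => x y; congr pair; rewrite /= component_sum. Qed.
Fact sum_componentK p q x :
  sum_component p (sum_component q x) = if p == q then sum_component q x else 0.
Proof. by rewrite /sum_component /= !componentK; case: ifP. Qed.

Definition sum_super : superspace K :=
  Superspace sum_component_linear sum_component_sum sum_componentK.

Lemma sum_homog p (x : sum_super) :
  (x \in homog p) = (x.1 \in homog p) && (x.2 \in homog p).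
Proof. by rewrite !inE; case: x. Qed.

Definition sum_bracket (x y : sum_super) : sum_super :=
  (bracket x.1 y.1, bracket x.2 y.2).

Fact sum_bracket_linearl y : linear (sum_bracket^~ y).
Proof.
by move=> a x z; rewrite /sum_bracket /= !bracketDl !bracketZl.
Qed.
Fact sum_bracket_linearr x : linear (sum_bracket x).
Proof. by move=> a y z; rewrite /sum_bracket /= !linearP. Qed.
Fact sum_bracket_homog p q (x y : sum_super) : x \in homog p ->
    y \in homog q ->
  sum_bracket x y \in homog (p (+) q).
Proof.
rewrite !sum_homog => /andP[hx1 hx2] /andP[hy1 hy2].
by rewrite !bracket_homog.
Qed.
Fact sum_bracket_skew p q (x y : sum_super) : x \in homog p ->
    y \in homog q ->
  sum_bracket x y = - ((-1) ^+ (p && q) *: sum_bracket y x).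
Proof.
rewrite !sum_homog => /andP[hx1 hx2] /andP[hy1 hy2].
by rewrite /sum_bracket (bracket_skew hx1 hy1) (bracket_skew hx2 hy2).
Qed.
Fact sum_bracket_jacobi p q (x y z : sum_super) :
  x \in homog p -> y \in homog q ->
  sum_bracket x (sum_bracket y z) = sum_bracket (sum_bracket x y) z +
    (-1) ^+ (p && q) *: sum_bracket y (sum_bracket x z).
Proof.
rewrite !sum_homog => /andP[hx1 hx2] /andP[hy1 hy2].
by rewrite /sum_bracket /= (bracket_jacobi _ hx1 hy1) (bracket_jacobi _ hx2 hy2).
Qed.

Definition sumLie : lieSuperalgebra K :=
  LieSuperalgebra sum_bracket_linearl sum_bracket_linearr sum_bracket_homog
    sum_bracket_skew sum_bracket_jacobi.

End SumLie.

End SuperTheory.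

(* U(g) is the unital associative K-algebra presented by generators UGen x,
   x in g, subject to linearity in x and
   x y - (-1)^{|x||y|} y x = [x, y] for homogeneous x and y. *)
Section Enveloping.
Variables (K : numFieldType) (g : lieSuperalgebra K).

Inductive uterm : Type :=
| UScal of K
| UGen of g
| UAdd of uterm & uterm
| UMul of uterm & uterm.

Inductive urel : uterm -> uterm -> Prop :=
| urel_refl s : urel s s
| urel_sym s t : urel s t -> urel t s
| urel_trans s t r : urel s t -> urel t r -> urel s r
| urel_add s s' t t' : urel s s' -> urel t t' -> urel (UAdd s t) (UAdd s' t')
| urel_mul s s' t t' : urel s s' -> urel t t' -> urel (UMul s t) (UMul s' t')
| urel_addA s t r : urel (UAdd s (UAdd t r)) (UAdd (UAdd s t) r)
| urel_addC s t : urel (UAdd s t) (UAdd t s)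
| urel_add0 s : urel (UAdd (UScal 0) s) s
| urel_addN s : urel (UAdd (UMul (UScal (-1)) s) s) (UScal 0)
| urel_mulA s t r : urel (UMul s (UMul t r)) (UMul (UMul s t) r)
| urel_mul1l s : urel (UMul (UScal 1) s) s
| urel_mul1r s : urel (UMul s (UScal 1)) s
| urel_mulDl s t r : urel (UMul (UAdd s t) r) (UAdd (UMul s r) (UMul t r))
| urel_mulDr s t r : urel (UMul s (UAdd t r)) (UAdd (UMul s t) (UMul s r))
| urel_scalD a b : urel (UScal (a + b)) (UAdd (UScal a) (UScal b))
| urel_scalM a b : urel (UScal (a * b)) (UMul (UScal a) (UScal b))
| urel_scalC a s : urel (UMul (UScal a) s) (UMul s (UScal a))
| urel_gen a x y :
    urel (UGen (a *: x + y)) (UAdd (UMul (UScal a) (UGen x)) (UGen y))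
| urel_bracket p q x y : x \in homog p ->
    y \in homog q ->
    urel (UGen (bracket x y))
      (UAdd (UMul (UGen x) (UGen y))
            (UMul (UScal (- (-1) ^+ (p && q))) (UMul (UGen y) (UGen x)))).

HB.instance Definition _ := gen_eqMixin uterm.
HB.instance Definition _ := gen_choiceMixin uterm.

Definition urelb (s t : uterm) : bool := `[< urel s t >].

Fact urelb_equiv : equiv_class_of urelb.
Proof.
split=> [s|s t|t s r].
- by apply/asboolP; exact: urel_refl.
- by apply: asbool_equiv_eq; split; exact: urel_sym.
- by move=> /asboolP st /asboolP tr; apply/asboolP; exact: urel_trans st tr.
Qed.

Canonical urel_equiv := EquivRelPack urelb_equiv.

Definition uenv := {eq_quot urel_equiv}.
HB.instance Definition _ := Choice.on uenv.
HB.instance Definition _ := EqQuotient.on uenv.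

Definition upi (t : uterm) : uenv := \pi_uenv t.

Lemma upiP s t : urel s t -> upi s = upi t.
Proof. by move=> st; apply/eqP; rewrite piE; apply/asboolP. Qed.

Lemma urel_repr t : urel (repr (upi t)) t.
Proof.
have: upi (repr (upi t)) == upi t by rewrite /upi reprK.
by rewrite piE => /asboolP.
Qed.

Lemma upi_repr (u : uenv) : upi (repr u) = u. Proof. exact: reprK. Qed.

Lemma uenvP (P : uenv -> Prop) : (forall t, P (upi t)) -> forall u, P u.
Proof. by move=> h u; rewrite -[u]reprK; exact: h. Qed.

Definition ulift (T : Type) (f : uterm -> T) (u : uenv) : T := f (repr u).

Lemma uliftE (T : Type) (f : uterm -> T) :
  (forall s t, urel s t -> f s = f t) -> forall t, ulift f (upi t) = f t.
Proof. by move=> h t; apply/h/urel_repr. Qed.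

Definition uscal (a : K) : uenv := upi (UScal a).
Definition ugen (x : g) : uenv := upi (UGen x).
Definition uadd (u v : uenv) : uenv := upi (UAdd (repr u) (repr v)).
Definition umul (u v : uenv) : uenv := upi (UMul (repr u) (repr v)).
Definition uopp (u : uenv) : uenv := umul (uscal (-1)) u.

Lemma upi_add s t : upi (UAdd s t) = uadd (upi s) (upi t).
Proof. by apply/upiP/urel_add; apply: urel_sym; exact: urel_repr. Qed.
Lemma upi_mul s t : upi (UMul s t) = umul (upi s) (upi t).
Proof. by apply/upiP/urel_mul; apply: urel_sym; exact: urel_repr. Qed.

Fact uaddA : associative uadd.
Proof.
elim/uenvP=> s; elim/uenvP=> t; elim/uenvP=> r; rewrite -!upi_add.
exact/upiP/urel_addA.
Qed.
Fact uaddC : commutative uadd.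
Proof.
by elim/uenvP=> s; elim/uenvP=> t; rewrite -!upi_add; exact/upiP/urel_addC.
Qed.
Fact uadd0 : left_id (uscal 0) uadd.
Proof. by elim/uenvP=> s; rewrite -!upi_add; exact/upiP/urel_add0. Qed.
Fact uaddN : left_inverse (uscal 0) uopp uadd.
Proof. by elim/uenvP=> s; rewrite /uopp -upi_mul -!upi_add; exact/upiP/urel_addN. Qed.

HB.instance Definition _ := GRing.isZmodule.Build uenv uaddA uaddC uadd0 uaddN.

Fact umulA : associative umul.
Proof.
elim/uenvP=> s; elim/uenvP=> t; elim/uenvP=> r; rewrite -!upi_mul.
exact/upiP/urel_mulA.
Qed.
Fact umul1l : left_id (uscal 1) umul.
Proof. by elim/uenvP=> s; rewrite -!upi_mul; exact/upiP/urel_mul1l. Qed.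
Fact umul1r : right_id (uscal 1) umul.
Proof. by elim/uenvP=> s; rewrite -!upi_mul; exact/upiP/urel_mul1r. Qed.
Fact umulDl : left_distributive umul +%R.
Proof.
elim/uenvP=> s; elim/uenvP=> t; elim/uenvP=> r.
rewrite -[LHS]/(umul (uadd _ _) _) -[RHS]/(uadd (umul _ _) (umul _ _)).
rewrite -!(upi_add, upi_mul).
exact/upiP/urel_mulDl.
Qed.
Fact umulDr : right_distributive umul +%R.
Proof.
elim/uenvP=> s; elim/uenvP=> t; elim/uenvP=> r.
rewrite -[LHS]/(umul _ (uadd _ _)) -[RHS]/(uadd (umul _ _) (umul _ _)).
rewrite -!(upi_add, upi_mul).
exact/upiP/urel_mulDr.
Qed.

HB.instance Definition _ :=
  GRing.Zmodule_isPzRing.Build uenv umulA umul1l umul1r umulDl umulDr.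

Lemma upiD s t : upi (UAdd s t) = upi s + upi t. Proof. exact: upi_add. Qed.
Lemma upiM s t : upi (UMul s t) = upi s * upi t. Proof. exact: upi_mul. Qed.
Lemma upi0 : upi (UScal 0) = 0. Proof. by []. Qed.
Lemma upi1 : upi (UScal 1) = 1. Proof. by []. Qed.

Lemma uscalD a b : uscal (a + b) = uscal a + uscal b.
Proof. by rewrite -upiD; exact/upiP/urel_scalD. Qed.
Lemma uscalM a b : uscal (a * b) = uscal a * uscal b.
Proof. by rewrite -upiM; exact/upiP/urel_scalM. Qed.
Lemma uscalC a (u : uenv) : uscal a * u = u * uscal a.
Proof. by elim/uenvP: u => t; rewrite -!upiM; exact/upiP/urel_scalC. Qed.

Definition uscale (a : K) (u : uenv) : uenv := uscal a * u.

Fact uscaleA a b u : uscale a (uscale b u) = uscale (a * b) u.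
Proof. by rewrite /uscale mulrA uscalM. Qed.
Fact uscale1 : left_id 1 uscale.
Proof. by move=> u; rewrite /uscale mul1r. Qed.
Fact uscaleDr : right_distributive uscale +%R.
Proof. by move=> a u v; rewrite /uscale mulrDr. Qed.
Fact uscaleDl u : {morph uscale^~ u : a b / a + b}.
Proof. by move=> a b; rewrite /uscale uscalD mulrDl. Qed.

HB.instance Definition _ :=
  GRing.Zmodule_isLmodule.Build K uenv uscaleA uscale1 uscaleDr uscaleDl.

Lemma uscaleE a (u : uenv) : a *: u = uscal a * u. Proof. by []. Qed.
Lemma uscalE a : uscal a = a *: (1 : uenv). Proof. by rewrite uscaleE mulr1. Qed.
Lemma umulAl a (u v : uenv) : a *: (u * v) = (a *: u) * v.
Proof. by rewrite !uscaleE mulrA. Qed.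
Lemma umulAr a (u v : uenv) : a *: (u * v) = u * (a *: v).
Proof. by rewrite !uscaleE !mulrA (uscalC a u). Qed.

Fact ugen_linear : linear ugen.
Proof.
move=> a x y; rewrite uscaleE -upiM -upiD; exact/upiP/urel_gen.
Qed.
HB.instance Definition _ := GRing.isLinear.Build K g uenv *:%R ugen ugen_linear.

Lemma ugen_bracket p q x y : x \in homog p ->
    y \in homog q ->
  ugen (bracket x y) = ugen x * ugen y - (-1) ^+ (p && q) *: (ugen y * ugen x).
Proof.
move=> hx hy; rewrite -scaleNr uscaleE /uscal /ugen -!upiM -upiD.
exact/upiP/urel_bracket.
Qed.

(* The grading of U(g) induced by that of g: scalars are even and degrees add
   up in products. *)
Fixpoint ucomp_term (p : bool) (t : uterm) : uenv :=
  match t with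
  | UScal a => if p then 0 else uscal a
  | UGen x => ugen (component p x)
  | UAdd s t => ucomp_term p s + ucomp_term p t
  | UMul s t => ucomp_term false s * ucomp_term p t +
                ucomp_term true s * ucomp_term (~~ p) t
  end.

Lemma ucomp_term_rel s t : urel s t -> forall p, ucomp_term p s = ucomp_term p t.
Proof.
elim=> {s t} //=.
- by move=> s t r _ st _ tr p; rewrite st.
- by move=> s s' t t' _ hs _ ht p; rewrite hs ht.
- by move=> s s' t t' _ hs _ ht p; rewrite !hs !ht.
- by move=> s t r p; rewrite addrA.
- by move=> s t p; rewrite addrC.
- by move=> s [] /=; rewrite add0r.
- move=> s p; rewrite mul0r addr0 -[X in _ + X]mul1r -mulrDl.
  by rewrite -[(1 : uenv)]/(uscal 1) -uscalD addNr; case: p; rewrite mul0r.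
- move=> s t r p; rewrite !mulrDr !mulrDl !mulrA -!addrA /= negbK.
  by congr (_ + _); rewrite addrA addrC.
- by move=> s p; rewrite mul1r mul0r addr0.
- by move=> s [] /=; rewrite mulr1 mulr0 ?add0r ?addr0.
- move=> s t r p; rewrite !mulrDl -!addrA; congr (_ + _).
  by rewrite addrCA.
- move=> s t r p; rewrite !mulrDr -!addrA; congr (_ + _).
  by rewrite addrCA.
- by move=> a b [] /=; rewrite ?addr0 // uscalD.
- by move=> a b [] /=; rewrite !(mul0r, mulr0) addr0 ?uscalM.
- by move=> a s [] /=; rewrite !(mul0r, mulr0) ?addr0 ?add0r uscalC.
- by move=> a x y p; rewrite mul0r addr0 !linearP.
- move=> p q x y hx hy r; have hxy := bracket_homog hx hy.
  rewrite mul0r addr0 -uscaleE (homogE _ hxy) !(homogE _ hx) !(homogE _ hy).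
  have E := ugen_bracket hx hy.
  case: p q r hx hy {hxy} E => [] [] [] /= hx hy E;
  by rewrite ?linear0 ?(mul0r, mulr0, add0r, addr0) ?scaler0 ?addr0 //
       E !scaleNr ?addr0 ?add0r.
Qed.

Definition ucomp (p : bool) : uenv -> uenv := ulift (ucomp_term p).

Lemma ucompE p t : ucomp p (upi t) = ucomp_term p t.
Proof. by apply: uliftE => s r sr; exact: ucomp_term_rel. Qed.

Lemma ucompD p (u v : uenv) : ucomp p (u + v) = ucomp p u + ucomp p v.
Proof. by elim/uenvP: u => s; elim/uenvP: v => t; rewrite -upiD !ucompE. Qed.

Lemma ucompM p (u v : uenv) :
  ucomp p (u * v) = ucomp false u * ucomp p v + ucomp true u * ucomp (~~ p) v.
Proof. by elim/uenvP: u => s; elim/uenvP: v => t; rewrite -upiM !ucompE. Qed.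

Lemma ucomp_scal p a : ucomp p (uscal a) = if p then 0 else uscal a.
Proof. exact: ucompE. Qed.

Lemma ucomp0 p : ucomp p 0 = 0.
Proof. by rewrite [LHS](ucomp_scal p 0); case: p. Qed.

Lemma ucomp_gen p x : ucomp p (ugen x) = ugen (component p x).
Proof. exact: ucompE. Qed.

Fact ucomp_linear p : linear (ucomp p).
Proof.
move=> a u v; rewrite ucompD uscaleE ucompM !ucomp_scal.
by rewrite mul0r addr0.
Qed.

Fact ucomp_sum u : ucomp false u + ucomp true u = u.
Proof.
elim/uenvP: u => t; rewrite !ucompE; elim: t => [a|x|s hs t ht|s hs t ht] /=.
- by rewrite addr0.
- by rewrite -linearD component_sum.
- by rewrite addrACA hs ht -upiD.
- by rewrite upiM -hs -ht mulrDl !mulrDr addrACA [X in _ + X]addrC addrA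
     -!addrA.
Qed.

Fact ucompK p q u : ucomp p (ucomp q u) = if p == q then ucomp q u else 0.
Proof.
elim/uenvP: u => t; rewrite !ucompE.
elim: t p q => [a|x|s hs t ht|s hs t ht] p q /=.
- case: q; rewrite ?ucomp_scal; last by case: p.
  by rewrite /= if_same; case: p.
- by rewrite ucomp_gen componentK; case: ifP => // _; rewrite linear0.
- by rewrite ucompD hs ht; case: ifP => // _; rewrite addr0.
- rewrite ucompD !ucompM !hs !ht /=.
  by case: p; case: q; rewrite /= ?(mul0r, mulr0, add0r, addr0).
Qed.

Definition uenv_super : superspace K :=
  Superspace ucomp_linear ucomp_sum ucompK.

Section Act.
Variable M : lieModule g.

Fixpoint uact_term (t : uterm) (m : M) : M :=
  match t with
  | UScal a => a *: m
  | UGen x => action x m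
  | UAdd s t => uact_term s m + uact_term t m
  | UMul s t => uact_term s (uact_term t m)
  end.

Lemma uact_term_linear t : linear (uact_term t).
Proof.
elim: t => [b|x|s hs t ht|s hs t ht] a u v /=.
- by rewrite scalerDr !scalerA mulrC.
- by rewrite linearP.
- by rewrite hs ht scalerDr addrACA.
- by rewrite ht hs.
Qed.

HB.instance Definition _ t :=
  GRing.isLinear.Build K M M *:%R (uact_term t) (uact_term_linear t).

Lemma uact_term_rel s t : urel s t -> uact_term s =1 uact_term t.
Proof.
elim=> {s t} //=.
- by move=> s t _ h m; rewrite h.
- by move=> s t r _ st _ tr m; rewrite st.
- by move=> s s' t t' _ hs _ ht m; rewrite hs ht.
- by move=> s s' t t' _ hs _ ht m; rewrite hs ht.
- by move=> s t r m; rewrite addrA.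
- by move=> s t m; rewrite addrC.
- by move=> s m; rewrite scale0r add0r.
- by move=> s m; rewrite scaleN1r addNr scale0r.
- by move=> s m; rewrite scale1r.
- by move=> s m; rewrite scale1r.
- by move=> s t r m; rewrite linearD.
- by move=> a b m; rewrite scalerDl.
- by move=> a b m; rewrite scalerA.
- by move=> a s m; rewrite linearZ.
- by move=> a x y m; rewrite actionDl actionZl.
- by move=> p q x y hx hy m; rewrite (action_bracket _ hx hy) scaleNr.
Qed.

Definition uact (u : uenv) : M -> M := ulift uact_term u.

Lemma uactE t : uact (upi t) = uact_term t.
Proof. by apply: uliftE => s r sr; apply/funext/uact_term_rel. Qed.

Fact uact_linear u : linear (uact u).
Proof. exact: uact_term_linear. Qed.
HB.instance Definition _ u :=
  GRing.isLinear.Build K M M *:%R (uact u) (uact_linear u).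

Lemma uact_gen x m : uact (ugen x) m = action x m. Proof. by rewrite uactE. Qed.
Lemma uact_scal a m : uact (uscal a) m = a *: m. Proof. by rewrite uactE. Qed.
Lemma uactD u v m : uact (u + v) m = uact u m + uact v m.
Proof. by elim/uenvP: u => s; elim/uenvP: v => t; rewrite -upiD !uactE. Qed.
Lemma uactM u v m : uact (u * v) m = uact u (uact v m).
Proof. by elim/uenvP: u => s; elim/uenvP: v => t; rewrite -upiM !uactE. Qed.

Lemma component_uact p u m :
  component p (uact u m) =
    uact (ucomp false u) (component p m) +
    uact (ucomp true u) (component (~~ p) m).
Proof.
elim/uenvP: u => t; rewrite !ucompE uactE.
elim: t p m => [a|x|s hs t ht|s hs t ht] p m /=.
- by rewrite uact_scal -upi0 uact_scal scale0r addr0 linearZ.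
- by rewrite !uact_gen component_action.
- by rewrite linearD /= hs ht !uactD addrACA.
- have D u v w : uact u (v + w) = uact u v + uact u w.
    by have := uact_linear u 1 v w; rewrite !scale1r.
  rewrite hs !ht !uactD !uactM !D /= negbK; rewrite -!addrA; congr (_ + _).
  by rewrite addrA addrC.
Qed.

End Act.
End Enveloping.

Section EnvelopingMap.
Variables (K : numFieldType) (h g : lieSuperalgebra K) (phi : lieHom h g).

Fixpoint umap_term (t : uterm h) : uenv g :=
  match t with
  | UScal a => uscal g a
  | UGen x => ugen (phi x)
  | UAdd s t => umap_term s + umap_term t
  | UMul s t => umap_term s * umap_term t
  end.

Lemma lie_fun_homog p x : x \in homog p -> phi x \in homog p.
Proof. by rewrite !inE -lie_fun_component => /eqP ->. Qed.

Lemma umap_term_rel s t : urel s t -> umap_term s = umap_term t.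
Proof.
elim=> {s t} //=.
- by move=> s t r _ -> _ ->.
- by move=> s s' t t' _ -> _ ->.
- by move=> s s' t t' _ -> _ ->.
- by move=> s t r; rewrite addrA.
- by move=> s t; rewrite addrC.
- by move=> s; rewrite add0r.
- move=> s; rewrite -[X in _ + X]mul1r -mulrDl.
  by rewrite -[(1 : uenv g)]/(uscal g 1) -uscalD addNr mul0r.
- by move=> s t r; rewrite mulrA.
- by move=> s; rewrite mul1r.
- by move=> s; rewrite mulr1.
- by move=> s t r; rewrite mulrDl.
- by move=> s t r; rewrite mulrDr.
- by move=> a b; rewrite uscalD.
- by move=> a b; rewrite uscalM.
- by move=> a s; rewrite uscalC.
- by move=> a x y; rewrite !linearP.
- move=> p q x y hx hy.
  rewrite lie_fun_bracket (ugen_bracket (lie_fun_homog hx) (lie_fun_homog hy)).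
  by rewrite -uscaleE scaleNr.
Qed.

Definition umap : uenv h -> uenv g := ulift umap_term.

Lemma umapE t : umap (upi t) = umap_term t.
Proof. by apply: uliftE; exact: umap_term_rel. Qed.
Lemma umap_gen x : umap (ugen x) = ugen (phi x). Proof. exact: umapE. Qed.
Lemma umap_scal a : umap (uscal h a) = uscal g a. Proof. exact: umapE. Qed.
Lemma umapD u v : umap (u + v) = umap u + umap v.
Proof. by elim/uenvP: u => s; elim/uenvP: v => t; rewrite -upiD !umapE. Qed.
Lemma umapM u v : umap (u * v) = umap u * umap v.
Proof. by elim/uenvP: u => s; elim/uenvP: v => t; rewrite -upiM !umapE. Qed.

Lemma umap_comp p u : ucomp p (umap u) = umap (ucomp p u).
Proof.
elim/uenvP: u => t; rewrite ucompE umapE.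
elim: t p => [a|x|s hs t ht|s hs t ht] p /=.
- rewrite ucomp_scal; case: p; last by rewrite umap_scal.
  by rewrite -[0 in RHS]upi0 umapE.
- by rewrite ucomp_gen umap_gen lie_fun_component.
- by rewrite ucompD umapD hs ht.
- by rewrite ucompM umapD !umapM !hs !ht.
Qed.

End EnvelopingMap.

(* U(g) (x)_{U(h)} M, for h acting on U(g) from the right through phi: the
   abelian group generated by the pure tensors u (x) m, subject to
   biadditivity and u s (x) m = u (x) s m for s in U(h). *)
Section Induced.
Variables (K : numFieldType) (h g : lieSuperalgebra K).
Variables (phi : lieHom h g) (M : lieModule h).

Inductive iterm : Type :=
| IZero
| IPure of uenv g & M
| IOpp of iterm
| IAdd of iterm & iterm.

Inductive irel : iterm -> iterm -> Prop :=
| irel_refl s : irel s s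
| irel_sym s t : irel s t -> irel t s
| irel_trans s t r : irel s t -> irel t r -> irel s r
| irel_opp s s' : irel s s' -> irel (IOpp s) (IOpp s')
| irel_add s s' t t' : irel s s' -> irel t t' -> irel (IAdd s t) (IAdd s' t')
| irel_addA s t r : irel (IAdd s (IAdd t r)) (IAdd (IAdd s t) r)
| irel_addC s t : irel (IAdd s t) (IAdd t s)
| irel_add0 s : irel (IAdd IZero s) s
| irel_addN s : irel (IAdd (IOpp s) s) IZero
| irel_pureDl u v m : irel (IPure (u + v) m) (IAdd (IPure u m) (IPure v m))
| irel_pureDr u m n : irel (IPure u (m + n)) (IAdd (IPure u m) (IPure u n))
| irel_balanced u s m : irel (IPure (u * umap phi s) m) (IPure u (uact s m)).

HB.instance Definition _ := gen_eqMixin iterm.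
HB.instance Definition _ := gen_choiceMixin iterm.

Definition irelb (s t : iterm) : bool := `[< irel s t >].

Fact irelb_equiv : equiv_class_of irelb.
Proof.
split=> [s|s t|t s r].
- by apply/asboolP; exact: irel_refl.
- by apply: asbool_equiv_eq; split; exact: irel_sym.
- by move=> /asboolP st /asboolP tr; apply/asboolP; exact: irel_trans st tr.
Qed.

Canonical irel_equiv := EquivRelPack irelb_equiv.

Definition ind := {eq_quot irel_equiv}.
HB.instance Definition _ := Choice.on ind.
HB.instance Definition _ := EqQuotient.on ind.

Definition ipi (t : iterm) : ind := \pi_ind t.

Lemma ipiP s t : irel s t -> ipi s = ipi t.
Proof. by move=> st; apply/eqP; rewrite piE; apply/asboolP. Qed.

Lemma irel_repr t : irel (repr (ipi t)) t.
Proof.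
have: ipi (repr (ipi t)) == ipi t by rewrite /ipi reprK.
by rewrite piE => /asboolP.
Qed.

Lemma indP (P : ind -> Prop) : (forall t, P (ipi t)) -> forall w, P w.
Proof. by move=> H w; rewrite -[w]reprK; exact: H. Qed.

Definition ilift (T : Type) (f : iterm -> T) (w : ind) : T := f (repr w).

Lemma iliftE (T : Type) (f : iterm -> T) :
  (forall s t, irel s t -> f s = f t) -> forall t, ilift f (ipi t) = f t.
Proof. by move=> H t; apply/H/irel_repr. Qed.

Definition iadd (v w : ind) : ind := ipi (IAdd (repr v) (repr w)).
Definition iopp (v : ind) : ind := ipi (IOpp (repr v)).

Lemma ipi_add s t : ipi (IAdd s t) = iadd (ipi s) (ipi t).
Proof. by apply/ipiP/irel_add; apply: irel_sym; exact: irel_repr. Qed.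
Lemma ipi_opp s : ipi (IOpp s) = iopp (ipi s).
Proof. by apply/ipiP/irel_opp; apply: irel_sym; exact: irel_repr. Qed.

Fact iaddA : associative iadd.
Proof.
elim/indP=> s; elim/indP=> t; elim/indP=> r; rewrite -!ipi_add.
exact/ipiP/irel_addA.
Qed.
Fact iaddC : commutative iadd.
Proof.
by elim/indP=> s; elim/indP=> t; rewrite -!ipi_add; exact/ipiP/irel_addC.
Qed.
Fact iadd0 : left_id (ipi IZero) iadd.
Proof. by elim/indP=> s; rewrite -!ipi_add; exact/ipiP/irel_add0. Qed.
Fact iaddN : left_inverse (ipi IZero) iopp iadd.
Proof. by elim/indP=> s; rewrite -ipi_opp -!ipi_add; exact/ipiP/irel_addN. Qed.

HB.instance Definition _ := GRing.isZmodule.Build ind iaddA iaddC iadd0 iaddN.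

Definition ipure (u : uenv g) (m : M) : ind := ipi (IPure u m).

Lemma ipi0 : ipi IZero = 0. Proof. by []. Qed.
Lemma ipiD s t : ipi (IAdd s t) = ipi s + ipi t. Proof. exact: ipi_add. Qed.
Lemma ipiN s : ipi (IOpp s) = - ipi s. Proof. exact: ipi_opp. Qed.
Lemma ipureDl u v m : ipure (u + v) m = ipure u m + ipure v m.
Proof. by rewrite -ipiD; exact/ipiP/irel_pureDl. Qed.
Lemma ipureDr u m n : ipure u (m + n) = ipure u m + ipure u n.
Proof. by rewrite -ipiD; exact/ipiP/irel_pureDr. Qed.
Lemma ipure_balanced u s m : ipure (u * umap phi s) m = ipure u (uact s m).
Proof. exact/ipiP/irel_balanced. Qed.

Lemma ind_ind (P : ind -> Prop) :
  P 0 -> (forall v, P v -> P (- v)) -> (forall v w, P v -> P w -> P (v + w)) ->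
  (forall u m, P (ipure u m)) -> forall w, P w.
Proof.
move=> P0 PN PD Pp; elim/indP; elim=> [|u m|s Ps|s Ps t Pt] //.
- exact: Pp.
- by rewrite ipiN; exact: PN.
- by rewrite ipiD; exact: PD.
Qed.

(* Any balanced biadditive map out of U(g) x M extends to the tensor product. *)
Section Lift.
Variables (A : zmodType) (f : uenv g -> M -> A).
Hypothesis fDl : forall u v m, f (u + v) m = f u m + f v m.
Hypothesis fDr : forall u m n, f u (m + n) = f u m + f u n.
Hypothesis f_bal : forall u s m, f (u * umap phi s) m = f u (uact s m).

Fixpoint ilin_term (t : iterm) : A :=
  match t with
  | IZero => 0
  | IPure u m => f u m
  | IOpp s => - ilin_term s
  | IAdd s t => ilin_term s + ilin_term t
  end.

Lemma ilin_term_rel s t : irel s t -> ilin_term s = ilin_term t.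
Proof.
elim=> {s t} //=.
- by move=> s t r _ -> _ ->.
- by move=> s s' _ ->.
- by move=> s s' t t' _ -> _ ->.
- by move=> s t r; rewrite addrA.
- by move=> s t; rewrite addrC.
- by move=> s; rewrite add0r.
- by move=> s; rewrite addNr.
Qed.

Lemma ilin_pure u m : ilift ilin_term (ipure u m) = f u m.
Proof. by rewrite iliftE //; exact: ilin_term_rel. Qed.

Lemma ilinD v w :
  ilift ilin_term (v + w) = ilift ilin_term v + ilift ilin_term w.
Proof.
elim/indP: v => s; elim/indP: w => t.
by rewrite -ipiD !iliftE //; exact: ilin_term_rel.
Qed.

Lemma ilinN v : ilift ilin_term (- v) = - ilift ilin_term v.
Proof.
by elim/indP: v => s; rewrite -ipiN !iliftE //; exact: ilin_term_rel.
Qed.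

Lemma ilin0 : ilift ilin_term 0 = 0.
Proof. by rewrite -ipi0 iliftE //; exact: ilin_term_rel. Qed.

End Lift.

Definition iact (u : uenv g) : ind -> ind :=
  ilift (ilin_term (fun v m => ipure (u * v) m)).

Fact iact_fDl u v w m : ipure (u * (v + w)) m = ipure (u * v) m + ipure (u * w) m.
Proof. by rewrite mulrDr ipureDl. Qed.
Fact iact_fDr u v m n : ipure (u * v) (m + n) = ipure (u * v) m + ipure (u * v) n.
Proof. exact: ipureDr. Qed.
Fact iact_bal u v s m : ipure (u * (v * umap phi s)) m = ipure (u * v) (uact s m).
Proof. by rewrite mulrA ipure_balanced. Qed.

Lemma iact_pure u v m : iact u (ipure v m) = ipure (u * v) m.
Proof. exact: (ilin_pure (iact_fDl u) (iact_fDr u) (iact_bal u)). Qed.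
Lemma iactDr u v w : iact u (v + w) = iact u v + iact u w.
Proof. exact: (ilinD (iact_fDl u) (iact_fDr u) (iact_bal u)). Qed.
Lemma iactNr u v : iact u (- v) = - iact u v.
Proof. exact: (ilinN (iact_fDl u) (iact_fDr u) (iact_bal u)). Qed.
Lemma iact0r u : iact u 0 = 0.
Proof. exact: (ilin0 (iact_fDl u) (iact_fDr u) (iact_bal u)). Qed.

Lemma iactDl u v w : iact (u + v) w = iact u w + iact v w.
Proof.
elim/ind_ind: w => [|w hw|w w' hw hw'|v' m].
- by rewrite !iact0r addr0.
- by rewrite !iactNr hw opprD.
- by rewrite !iactDr hw hw' addrACA.
- by rewrite !iact_pure mulrDl ipureDl.
Qed.

Lemma iact0l w : iact 0 w = 0.
Proof. by apply: (addIr (iact 0 w)); rewrite -iactDl !add0r. Qed.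

Lemma iactM u v w : iact (u * v) w = iact u (iact v w).
Proof.
elim/ind_ind: w => [|w hw|w w' hw hw'|v' m].
- by rewrite !iact0r.
- by rewrite !iactNr hw.
- by rewrite !iactDr hw hw'.
- by rewrite !iact_pure mulrA.
Qed.

Lemma iact1 w : iact 1 w = w.
Proof.
elim/ind_ind: w => [|w hw|w w' hw hw'|v' m].
- by rewrite !iact0r.
- by rewrite !iactNr hw.
- by rewrite !iactDr hw hw'.
- by rewrite !iact_pure mul1r.
Qed.

Definition iscale (a : K) (w : ind) : ind := iact (uscal g a) w.

Fact iscaleA a b w : iscale a (iscale b w) = iscale (a * b) w.
Proof. by rewrite /iscale uscalM iactM. Qed.
Fact iscale1 : left_id 1 iscale.
Proof. exact: iact1. Qed.
Fact iscaleDr : right_distributive iscale +%R.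
Proof. by move=> a u v; exact: iactDr. Qed.
Fact iscaleDl w : {morph iscale^~ w : a b / a + b}.
Proof. by move=> a b; rewrite /iscale uscalD iactDl. Qed.

HB.instance Definition _ :=
  GRing.Zmodule_isLmodule.Build K ind iscaleA iscale1 iscaleDr iscaleDl.

Lemma iscaleE a (w : ind) : a *: w = iact (uscal g a) w. Proof. by []. Qed.

Lemma iact_linear u : linear (iact u).
Proof. by move=> a v w; rewrite iactDr !iscaleE -!iactM uscalC. Qed.

Lemma iactZl a u w : iact (a *: u) w = a *: iact u w.
Proof. by rewrite uscaleE iactM. Qed.

Lemma ipureZl a u m : ipure (a *: u) m = a *: ipure u m.
Proof. by rewrite iscaleE iact_pure. Qed.

Lemma ipureZr a u m : ipure u (a *: m) = a *: ipure u m.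
Proof.
by rewrite -uact_scal -ipure_balanced umap_scal -uscalC -uscaleE ipureZl.
Qed.

Definition icomp_pure (p : bool) (u : uenv g) (m : M) : ind :=
  ipure (ucomp false u) (component p m) +
  ipure (ucomp true u) (component (~~ p) m).

Definition icomp (p : bool) : ind -> ind := ilift (ilin_term (icomp_pure p)).

Fact icomp_pureDl p u v m :
  icomp_pure p (u + v) m = icomp_pure p u m + icomp_pure p v m.
Proof. by rewrite /icomp_pure !ucompD !ipureDl addrACA. Qed.
Fact icomp_pureDr p u m n :
  icomp_pure p u (m + n) = icomp_pure p u m + icomp_pure p u n.
Proof. by rewrite /icomp_pure !linearD !ipureDr addrACA. Qed.
Fact icomp_pure_bal p u s m :
  icomp_pure p (u * umap phi s) m = icomp_pure p u (uact s m).
Proof.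
rewrite /icomp_pure !ucompM !umap_comp !component_uact !ipureDl !ipureDr /=.
rewrite !ipure_balanced negbK -!addrA; congr (_ + _).
by rewrite addrC -addrA.
Qed.

Lemma icompE p u m : icomp p (ipure u m) = icomp_pure p u m.
Proof.
exact: (ilin_pure (icomp_pureDl p) (icomp_pureDr p) (@icomp_pure_bal p)).
Qed.
Lemma icompD p v w : icomp p (v + w) = icomp p v + icomp p w.
Proof.
exact: (ilinD (icomp_pureDl p) (icomp_pureDr p) (@icomp_pure_bal p)).
Qed.
Lemma icompN p v : icomp p (- v) = - icomp p v.
Proof.
exact: (ilinN (icomp_pureDl p) (icomp_pureDr p) (@icomp_pure_bal p)).
Qed.
Lemma icomp0 p : icomp p 0 = 0.
Proof.
exact: (ilin0 (icomp_pureDl p) (icomp_pureDr p) (@icomp_pure_bal p)).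
Qed.

Lemma icomp_act p u w :
  icomp p (iact u w) =
    iact (ucomp false u) (icomp p w) + iact (ucomp true u) (icomp (~~ p) w).
Proof.
elim/ind_ind: w => [|w hw|w w' hw hw'|v m].
- by rewrite !(icomp0, iact0r) addr0.
- by rewrite !(icompN, iactNr) hw opprD.
- by rewrite !(icompD, iactDr) hw hw' addrACA.
- rewrite !(icompE, iact_pure) /icomp_pure !iactDr !iact_pure !ucompM !ipureDl.
  rewrite /= negbK -!addrA; congr (_ + _).
  by rewrite addrC -addrA.
Qed.

Fact icomp_linear p : linear (icomp p).
Proof.
move=> a v w; rewrite icompD iscaleE icomp_act !ucomp_scal; congr (_ + _).
by rewrite /= iact0l addr0.
Qed.

Fact icomp_sum w : icomp false w + icomp true w = w.
Proof.
elim/ind_ind: w => [|w hw|w w' hw hw'|u m].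
- by rewrite !icomp0 addr0.
- by rewrite !icompN -opprD hw.
- by rewrite !icompD addrACA hw hw'.
- rewrite !icompE /icomp_pure /= addrACA -!ipureDr.
  by rewrite [component true m + _]addrC component_sum -ipureDl ucomp_sum.
Qed.

Fact icompK p q w : icomp p (icomp q w) = if p == q then icomp q w else 0.
Proof.
elim/ind_ind: w => [|w hw|w w' hw hw'|u m].
- by rewrite !icomp0 if_same.
- by rewrite !icompN hw; case: ifP => // _; rewrite oppr0.
- by rewrite !icompD hw hw'; case: ifP => // _; rewrite addr0.
- have P0l n : ipure 0 n = 0 by rewrite -(scale0r 0) ipureZl scale0r.
  have P0r v : ipure v 0 = 0 by rewrite -(scale0r 0) ipureZr scale0r.
  rewrite icompE icompD !icompE /icomp_pure !ucompK !componentK.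
  by case: p; case: q; rewrite /= !(P0l, P0r) ?(addr0, add0r).
Qed.

Definition ind_super : superspace K :=
  Superspace icomp_linear icomp_sum icompK.

Definition ind_action (x : g) (w : ind_super) : ind_super := iact (ugen x) w.

Fact ind_action_linearl w : linear (ind_action^~ w).
Proof. by move=> a x y; rewrite /ind_action linearP iactDl iactZl. Qed.
Fact ind_action_linearr x : linear (ind_action x).
Proof. exact: iact_linear. Qed.
Fact ind_action_homog p q x (w : ind_super) : x \in homog p -> w \in homog q ->
  ind_action x w \in homog (p (+) q).
Proof.
move=> hx hw; have hw' r : icomp r w = if r == q then w else 0 by exact: (homogE r hw).
rewrite inE; apply/eqP; rewrite [LHS]icomp_act !ucomp_gen !(homogE _ hx) !hw'.
have Z : iact (ugen (0 : g)) w = 0 by rewrite linear0 iact0l.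
by case: p {hx}; case: q {hw hw'}; rewrite /= ?iact0r ?Z ?(addr0, add0r).
Qed.
Fact ind_action_bracket p q x y w : x \in homog p ->
    y \in homog q ->
  ind_action (bracket x y) w = ind_action x (ind_action y w) -
    (-1) ^+ (p && q) *: ind_action y (ind_action x w).
Proof.
move=> hx hy; rewrite /ind_action (ugen_bracket hx hy) iactDl -scaleNr iactZl.
by rewrite !iactM scaleNr.
Qed.

Definition indModule : lieModule g :=
  LieModule ind_action_linearl ind_action_linearr ind_action_homog
    ind_action_bracket.

End Induced.

(* The Jacobi identity on basis vectors, for an abstract bilinear bracket B. *)
Section JacobiCore.
Variables (K : numFieldType) (h : K) (hz : int) (hE : h = hz%:~R / 2).
Variables (V : lmodType K) (B : V -> V -> V) (L G : int -> V) (C : V).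
Hypothesis BDl : forall x y z, B (x + y) z = B x z + B y z.
Hypothesis BDr : forall x y z, B x (y + z) = B x y + B x z.
Hypothesis BZl : forall a x z, B (a *: x) z = a *: B x z.
Hypothesis BZr : forall a x z, B x (a *: z) = a *: B x z.
Hypothesis BCl : forall x, B C x = 0.
Hypothesis BCr : forall x, B x C = 0.
Hypothesis BLL : forall m n, B (L m) (L n) = (m - n)%:~R *: L (m + n) +
  (if m + n == 0 then (m ^+ 3 - m)%:~R / 12 else 0) *: C.
Hypothesis BLG : forall m k,
  B (L m) (G k) = (m%:~R / 2 - (k%:~R + h)) *: G (m + k).
Hypothesis BGL : forall k m,
  B (G k) (L m) = - ((m%:~R / 2 - (k%:~R + h)) *: G (m + k)).
Hypothesis BGG : forall k l, B (G k) (G l) = 2 *: L (k + l + hz) +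
  (if k + l + hz == 0 then ((k%:~R + h) ^+ 2 - 1 / 4) / 3 else 0) *: C.

Let BE := (BDl, BDr, BZl, BZr, BCl, BCr, scaler0, addr0).
Let BNl x z : B (- x) z = - B x z.
Proof. by rewrite -scaleN1r BZl scaleN1r. Qed.
Let BNr x z : B x (- z) = - B x z.
Proof. by rewrite -scaleN1r BZr scaleN1r. Qed.

Lemma core_LLL m n l : B (L m) (B (L n) (L l)) =
  B (B (L m) (L n)) (L l) + B (L n) (B (L m) (L l)).
Proof.
rewrite !(BLL, BE) !scalerDr !scalerA.
have -> : m + n + l = m + (n + l) by ring.
have -> : n + (m + l) = m + (n + l) by ring.
rewrite addrACA -!scalerDl; congr (_ *: _ + _ *: _).
  by rewrite -!intrM -intrD; congr (_%:~R); ring.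
case: ifP => [/eqP e|_]; last by rewrite !mulr0 ?oppr0 addr0.
have -> : m = - (n + l) by apply/eqP; rewrite -addr_eq0 e.
by field.
Qed.

Lemma core_LLG m n l : B (L m) (B (L n) (G l)) =
  B (B (L m) (L n)) (G l) + B (L n) (B (L m) (G l)).
Proof.
rewrite !(BLG, BLL, BE) ?scalerA.
have -> : m + n + l = m + (n + l) by ring.
have -> : n + (m + l) = m + (n + l) by ring.
by rewrite -!scalerDl; congr (_ *: _); field.
Qed.

Lemma core_LGL m n l : B (L m) (B (G n) (L l)) =
  B (B (L m) (G n)) (L l) + B (G n) (B (L m) (L l)).
Proof.
rewrite !(BLG, BGL, BLL, BE, BNr, BNl) ?scalerA.
have -> : l + (m + n) = m + (l + n) by ring.
have -> : m + l + n = m + (l + n) by ring.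
by rewrite -!scaleNr ?scalerA -!scalerDl; congr (_ *: _); field.
Qed.

Lemma core_GLL m n l : B (G m) (B (L n) (L l)) =
  B (B (G m) (L n)) (L l) + B (L n) (B (G m) (L l)).
Proof.
rewrite !(BLG, BGL, BLL, BE, BNr, BNl) ?scalerA.
have -> : l + (n + m) = n + (l + m) by ring.
have -> : n + l + m = n + (l + m) by ring.
by rewrite -!scaleNr ?scalerA -!scalerDl; congr (_ *: _); field.
Qed.

Lemma core_LGG m n l : B (L m) (B (G n) (G l)) =
  B (B (L m) (G n)) (G l) + B (G n) (B (L m) (G l)).
Proof.
rewrite !(BLG, BGL, BLL, BGG, BE, BNr, BNl) ?scalerDr ?scalerA.
have -> : m + (n + l + hz) = m + n + l + hz by ring.
have -> : n + (m + l) + hz = m + n + l + hz by ring.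
rewrite addrACA -!scalerDl hE; congr (_ *: _ + _ *: _).
  by field.
case: ifP => [/eqP e|_]; last by rewrite !mulr0 ?oppr0 addr0.
have -> : m = - (n + l + hz) by apply/eqP; rewrite -addr_eq0 !addrA e.
by field.
Qed.

Lemma core_GLG m n l : B (G m) (B (L n) (G l)) =
  B (B (G m) (L n)) (G l) + B (L n) (B (G m) (G l)).
Proof.
rewrite !(BLG, BGL, BLL, BGG, BE, BNr, BNl) ?scalerDr ?scalerA.
rewrite ?opprK ?[- (_ *: _ + _ *: _)]opprD -!scaleNr ?scalerA.
have -> : n + (m + l + hz) = n + m + l + hz by ring.
have -> : m + (n + l) + hz = n + m + l + hz by ring.
rewrite addrACA -!scalerDl hE; congr (_ *: _ + _ *: _).
  by field.
case: ifP => [/eqP e|_]; last by rewrite !mulr0 ?oppr0 addr0.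
have -> : n = - (m + l + hz) by apply/eqP; rewrite -addr_eq0 !addrA e.
by field.
Qed.

Lemma core_GGL m n l : B (G m) (B (G n) (L l)) =
  B (B (G m) (G n)) (L l) - B (G n) (B (G m) (L l)).
Proof.
rewrite !(BLG, BGL, BLL, BGG, BE, BNr, BNl) ?scalerDr ?scalerA.
rewrite ?opprK ?[- (_ *: _ + _ *: _)]opprD -!scaleNr ?scalerA.
have -> : m + n + hz + l = m + n + l + hz by ring.
have -> : m + (l + n) + hz = m + n + l + hz by ring.
have -> : n + (l + m) + hz = m + n + l + hz by ring.
rewrite addrACA -!scalerDl hE; congr (_ *: _ + _ *: _).
  by field.
case: ifP => [/eqP e|_]; last by rewrite !mulr0 ?oppr0 addr0.
have -> : l = - (m + n + hz) by apply/eqP; rewrite -addr_eq0; apply/eqP; rewrite -[RHS]e; ring.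
by field.
Qed.

Lemma core_GGG m n l : B (G m) (B (G n) (G l)) =
  B (B (G m) (G n)) (G l) - B (G n) (B (G m) (G l)).
Proof.
rewrite !(BLG, BGL, BLL, BGG, BE, BNr, BNl) ?scalerDr ?scalerA.
rewrite ?opprK ?[- (_ *: _ + _ *: _)]opprD -!scaleNr ?scalerA.
have -> : n + l + hz + m = m + n + hz + l by ring.
have -> : m + l + hz + n = m + n + hz + l by ring.
by rewrite -!scalerDl hE; congr (_ *: _); field.
Qed.
End JacobiCore.

(* The boolean h encodes epsilon = h / 2; BG k stands for G_(k + epsilon). *)
Section SVir.
Variables (K : numFieldType) (h : bool).

Inductive basis : Type := BL of int | BG of int | BC.

Definition basis_code (b : basis) : int + int + unit :=
  match b with BL m => inl (inl m) | BG k => inl (inr k) | BC => inr tt end.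
Definition basis_decode (s : int + int + unit) : basis :=
  match s with inl (inl m) => BL m | inl (inr k) => BG k | inr _ => BC end.
Fact basis_codeK : cancel basis_code basis_decode. Proof. by case. Qed.
HB.instance Definition _ := Countable.copy basis (can_type basis_codeK).

Definition basis_parity (b : basis) : bool := if b is BG _ then true else false.

Definition svir_space : lmodType K := {malg K[basis]}.

Definition extend (V : lmodType K) (F : basis -> V) (x : svir_space) : V :=
  \sum_(b <- msupp x) x@_b *: F b.

Section Extend.
Variables (V : lmodType K) (F : basis -> V).

Lemma extendEw (d : {fset basis}) (x : svir_space) :
  (msupp x `<=` d)%fset -> extend F x = \sum_(b <- d) x@_b *: F b.
Proof.
move=> sxd; rewrite /extend (big_fset_incl _ sxd) // => b _ /mcoeff_outdom ->.
by rewrite scale0r.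
Qed.

Fact extend_linear : linear (extend F).
Proof.
move=> a x y; pose d := (msupp x `|` msupp y)%fset.
have sx : (msupp x `<=` d)%fset by exact: fsubsetUl.
have sy : (msupp y `<=` d)%fset by exact: fsubsetUr.
rewrite (extendEw sx) (extendEw sy) (@extendEw d).
  rewrite scaler_sumr -big_split /=; apply: eq_bigr => b _.
  by rewrite mcoeffD mcoeffZ scalerDl scalerA.
apply: fsubset_trans (msuppD_le _ _) _; rewrite fsubUset sy andbT.
exact: fsubset_trans (msuppZ_le _ _) sx.
Qed.
HB.instance Definition _ :=
  GRing.isLinear.Build K svir_space V *:%R (extend F) extend_linear.

Lemma extendU b : extend F << b >> = F b.
Proof. by rewrite (extendEw (msuppU_le (x := 1))) big_seq_fset1 mcoeffUU scale1r. Qed.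

End Extend.

Lemma svir_ind (P : svir_space -> Prop) :
  P 0 -> (forall a x y, P x -> P y -> P (a *: x + y)) ->
  (forall b, P << b >>) -> forall x, P x.
Proof.
move=> P0 PD Pb x; rewrite [x]monalgE; elim/big_ind: _ => // [y z Py Pz|b _].
  by rewrite -[y]scale1r; exact: PD.
have -> : << x@_b *g b >> = x@_b *: (<< b >> : svir_space).
  by apply/malgP => k; rewrite mcoeffZ !mcoeffU mulrnAr mulr1.
by rewrite -[_ *: _]addr0; exact: PD.
Qed.

Definition svir_component (p : bool) : svir_space -> svir_space :=
  extend (fun b => if basis_parity b == p then << b >> else 0).

Fact svir_component_linear p : linear (svir_component p).
Proof. exact: extend_linear. Qed.
HB.instance Definition _ p :=
  GRing.isLinear.Build K svir_space svir_space *:%R (svir_component p)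
    (svir_component_linear p).

Fact svir_component_sum x : svir_component false x + svir_component true x = x.
Proof.
elim/svir_ind: x => [|a x y hx hy|b].
- by rewrite !linear0 addr0.
- by rewrite !linearP addrACA -scalerDr /= hx hy.
- rewrite /svir_component !extendU.
  by case: b => [m|k|] /=; [exact: addr0 | exact: add0r | exact: addr0].
Qed.

Fact svir_componentK p q x : svir_component p (svir_component q x) =
  if p == q then svir_component q x else 0.
Proof.
elim/svir_ind: x => [|a x y hx hy|b].
- by rewrite !linear0 if_same.
- by rewrite !linearP /= hx hy; case: ifP => // _; rewrite scaler0 addr0.
- rewrite /svir_component !extendU; case: (boolP (basis_parity b == q)) => [/eqP <-|_].
    by rewrite extendU eq_sym.
  by rewrite linear0 if_same.
Qed.

Definition svir_super : superspace K :=
  Superspace svir_component_linear svir_component_sum svir_componentK.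

Lemma basis_homog b : (<< b >> : svir_super) \in homog (basis_parity b).
Proof. by rewrite inE /= /svir_component extendU eqxx. Qed.

Lemma svir_homog_ind p (P : svir_space -> Prop) :
  P 0 -> (forall a x y, P x -> P y -> P (a *: x + y)) ->
  (forall b, basis_parity b = p -> P << b >>) ->
  forall x : svir_super, x \in homog p -> P x.
Proof.
move=> P0 PD Pb x; rewrite inE => /eqP <-; rewrite [component p x]/(svir_component p x).
elim/svir_ind: x => [|a x y hx hy|b].
- by rewrite linear0.
- by rewrite linearP; exact: PD.
- by rewrite /svir_component extendU; case: eqP => // /Pb.
Qed.

Definition epsilon : K := h%:R / 2.

Definition half_index (k : int) : K := k%:~R + epsilon.

(* For r = k + epsilon and s = l + epsilon, r + s = k + l + h. *)
Definition basis_bracket (a b : basis) : svir_super :=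
  match a, b with
  | BL m, BL n => (m - n)%:~R *: << BL (m + n) >> +
      (if m + n == 0 then (m ^+ 3 - m)%:~R / 12 else 0) *: << BC >>
  | BL m, BG k => (m%:~R / 2 - half_index k) *: << BG (m + k) >>
  | BG k, BL m => - ((m%:~R / 2 - half_index k) *: << BG (m + k) >>)
  | BG k, BG l => 2 *: << BL (k + l + h%:Z) >> +
      (if k + l + h%:Z == 0 then (half_index k ^+ 2 - 1 / 4) / 3 else 0)
        *: << BC >>
  | BC, _ | _, BC => 0
  end.

Definition svir_bracket (x y : svir_super) : svir_super :=
  extend (fun a => extend (basis_bracket a) y) x.

Fact svir_bracket_linearl y : linear (svir_bracket^~ y).
Proof. exact: extend_linear. Qed.

Fact svir_bracket_linearr x : linear (svir_bracket x).
Proof.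
move=> a y z; rewrite /svir_bracket /extend scaler_sumr -big_split /=.
apply: eq_bigr => b _; rewrite -!/(extend _ _) linearP scalerDr !scalerA.
by rewrite mulrC.
Qed.

Definition svir_bracketl y x := svir_bracket x y.
HB.instance Definition _ y := GRing.isLinear.Build K svir_super svir_super *:%R
  (svir_bracketl y) (svir_bracket_linearl y).
HB.instance Definition _ x := GRing.isLinear.Build K svir_super svir_super *:%R
  (svir_bracket x) (svir_bracket_linearr x).

Lemma svir_bracketDl x y z :
  svir_bracket (x + y) z = svir_bracket x z + svir_bracket y z.
Proof. exact: (linearD (svir_bracketl z)). Qed.
Lemma svir_bracketZl a x z : svir_bracket (a *: x) z = a *: svir_bracket x z.
Proof. exact: (linearZZ (svir_bracketl z)). Qed.
Lemma svir_bracketNl x z : svir_bracket (- x) z = - svir_bracket x z.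
Proof. exact: (linearN (svir_bracketl z)). Qed.
Lemma svir_bracket0l z : svir_bracket 0 z = 0.
Proof. exact: (linear0 (svir_bracketl z)). Qed.

Lemma svir_bracketDr x y z :
  svir_bracket x (y + z) = svir_bracket x y + svir_bracket x z.
Proof. exact: linearD. Qed.
Lemma svir_bracketZr a x z : svir_bracket x (a *: z) = a *: svir_bracket x z.
Proof. exact: linearZZ. Qed.
Lemma svir_bracketNr x z : svir_bracket x (- z) = - svir_bracket x z.
Proof. exact: linearN. Qed.
Lemma svir_bracket0r z : svir_bracket z 0 = 0.
Proof. exact: linear0. Qed.

Lemma svir_bracketU a b : svir_bracket << a >> << b >> = basis_bracket a b.
Proof. by rewrite /svir_bracket !extendU. Qed.

Fact svir_bracket_homog p q (x y : svir_super) : x \in homog p ->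
    y \in homog q ->
  svir_bracket x y \in homog (p (+) q).
Proof.
move=> hx hy; move: x hx; apply: svir_homog_ind => [|c x x' hx hx'|a <-].
- by rewrite svir_bracket0l homog0.
- by rewrite svir_bracketDl svir_bracketZl homogD ?homogZ.
move: y hy; apply: svir_homog_ind => [|c y y' hx hx'|b <-].
- by rewrite svir_bracket0r homog0.
- by rewrite svir_bracketDr svir_bracketZr homogD ?homogZ.
rewrite svir_bracketU; case: a => [m|k|]; case: b => [n|l|] /=; try exact: (@homog0 _ svir_super).
- by apply: (@homogD _ svir_super); apply: (@homogZ _ svir_super); exact: basis_homog.
- by apply: (@homogZ _ svir_super); exact: basis_homog.
- by apply: (@homogN _ svir_super); apply: (@homogZ _ svir_super); exact: basis_homog.
- by apply: (@homogD _ svir_super); apply: (@homogZ _ svir_super); exact: basis_homog.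
Qed.

Fact svir_bracket_skew p q (x y : svir_super) : x \in homog p ->
    y \in homog q ->
  svir_bracket x y = - ((-1) ^+ (p && q) *: svir_bracket y x).
Proof.
move=> hx hy; move: x hx; apply: svir_homog_ind => [|c x x' hx hx'|a <-].
- by rewrite svir_bracket0l svir_bracket0r scaler0 oppr0.
- rewrite svir_bracketDl svir_bracketDr svir_bracketZl svir_bracketZr hx hx'.
  by rewrite scalerDr opprD scalerN !scalerA mulrC.
move: y hy; apply: svir_homog_ind => [|c y y' hx hx'|b <-].
- by rewrite svir_bracket0l svir_bracket0r scaler0 oppr0.
- rewrite svir_bracketDl svir_bracketDr svir_bracketZl svir_bracketZr hx hx'.
  by rewrite scalerDr opprD scalerN !scalerA mulrC.
rewrite !svir_bracketU; case: a => [m|k|]; case: b => [n|l|] /=;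
  rewrite ?expr0 ?expr1 ?scale1r ?scaleN1r ?opprK ?oppr0 //.
- rewrite opprD -!scaleNr [n + m]addrC; congr (_ *: _ + _ *: _).
    by rewrite -rmorphN opprB.
  case: ifP => [/eqP mn|_]; last by rewrite oppr0.
  have -> : m = - n by apply/eqP; rewrite -addr_eq0 mn.
  by rewrite -mulNr -rmorphN; congr (_%:~R / _); ring.
- rewrite [l + k]addrC; congr (_ *: _ + _ *: _).
  case: ifP => [/eqP kl|//].
  have -> : k = - (l + h%:Z) by apply/eqP; rewrite -addr_eq0 addrA kl.
  by rewrite /half_index /epsilon; field.
Qed.
Lemma svir_bracketCl x : svir_bracket << BC >> x = 0.
Proof.
elim/svir_ind: x => [|a x y hx hy|b]; first exact: svir_bracket0r.
- by rewrite svir_bracketDr svir_bracketZr hx hy scaler0 addr0.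
- by rewrite svir_bracketU.
Qed.

Lemma svir_bracketCr x : svir_bracket x << BC >> = 0.
Proof.
elim/svir_ind: x => [|a x y hx hy|b]; first exact: svir_bracket0l.
- by rewrite svir_bracketDl svir_bracketZl hx hy scaler0 addr0.
- by rewrite svir_bracketU; case: b.
Qed.

Fact basis_jacobi a b c :
  svir_bracket << a >> (svir_bracket << b >> << c >>) =
  svir_bracket (svir_bracket << a >> << b >>) << c >> +
  (-1) ^+ (basis_parity a && basis_parity b) *:
    svir_bracket << b >> (svir_bracket << a >> << c >>).
Proof.
have hE : epsilon = h%:Z%:~R / 2 by [].
have [BDl BDr] := (svir_bracketDl, svir_bracketDr).
have [BZl BZr] := (svir_bracketZl, svir_bracketZr).
have [BCl BCr] := (svir_bracketCl, svir_bracketCr).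
pose L m : svir_super := << BL m >>; pose G k : svir_super := << BG k >>.
have BLL m n := svir_bracketU (BL m) (BL n).
have BLG m n := svir_bracketU (BL m) (BG n).
have BGL m n := svir_bracketU (BG m) (BL n).
have BGG m n := svir_bracketU (BG m) (BG n).
case: a => [m|m|]; last first.
  by rewrite /= scale1r !BCl svir_bracket0l svir_bracket0r addr0.
all: case: b => [n|n|]; last first.
1,4: by rewrite /= ?andbF /= scale1r !BCl !BCr svir_bracket0l svir_bracket0r addr0.
all: case: c => [l|l|]; last first.
1,4,7,10: by rewrite !BCr !svir_bracket0r scaler0 addr0.
all: rewrite [basis_parity _ && _]/= ?expr0 ?expr1 ?scale1r ?scaleN1r.
- exact: (core_GGG hE BDl BDr BZl BZr BCl BCr BLG BGL BGG).
- exact: (core_GGL hE BDl BZl BZr BCl BLL BGL BGG).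
- exact: (core_GLG hE BDr BZl BZr BCr BLL BLG BGL BGG).
- exact: (core_GLL BDr BZl BZr BCr BLL BLG BGL).
- exact: (core_LGG hE BDr BZl BZr BCr BLL BLG BGG).
- exact: (core_LGL BDr BZl BZr BCr BLL BLG BGL).
- exact: (core_LLG BDl BZl BZr BCl BLL BLG).
- exact: (core_LLL BDl BDr BZl BZr BCl BCr BLL).
Qed.

Fact svir_bracket_jacobi p q (x y z : svir_super) :
  x \in homog p -> y \in homog q ->
  svir_bracket x (svir_bracket y z) = svir_bracket (svir_bracket x y) z +
    (-1) ^+ (p && q) *: svir_bracket y (svir_bracket x z).
Proof.
move=> hx hy; move: x hx; apply: svir_homog_ind => [|c x x' hx hx'|a <-].
- by rewrite !svir_bracket0l svir_bracket0r scaler0 addr0.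
- rewrite !(svir_bracketDl, svir_bracketDr, svir_bracketZl, svir_bracketZr).
  rewrite hx hx' !scalerDr !scalerA [c * _]mulrC -!addrA; congr (_ + _).
  by rewrite addrCA.
move: y hy; apply: svir_homog_ind => [|c y y' hy hy'|b <-].
- by rewrite !(svir_bracket0l, svir_bracket0r) scaler0 addr0.
- rewrite !(svir_bracketDl, svir_bracketDr, svir_bracketZl, svir_bracketZr).
  rewrite hy hy' !scalerDr !scalerA [c * _]mulrC -!addrA; congr (_ + _).
  by rewrite addrCA.
elim/svir_ind: z => [|c z z' hz hz'|d].
- by rewrite !svir_bracket0r scaler0 addr0.
- rewrite !(svir_bracketDr, svir_bracketZr) hz hz'.
  rewrite !scalerDr !scalerA [c * _]mulrC -!addrA; congr (_ + _).
  by rewrite addrCA.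
exact: basis_jacobi.
Qed.

Definition svir : lieSuperalgebra K :=
  LieSuperalgebra svir_bracket_linearl svir_bracket_linearr svir_bracket_homog
    svir_bracket_skew svir_bracket_jacobi.

Definition svirL (m : int) : svir := << BL m >>.
Definition svirG (k : int) : svir := << BG k >>.
Definition svirC : svir := << BC >>.

(* p_epsilon is spanned by the L_n, n >= 1, and the G_(n - epsilon), n >= 2;
   G_(n - epsilon) = BG k for k = n - h. *)
Definition p_basis (b : basis) : bool :=
  match b with BL m => 1 <= m | BG k => 2 <= k + h%:Z | BC => false end.

Definition p_mem : {pred svir} :=
  [pred x : svir_space | all p_basis (msupp x)].

Lemma p_memP (x : svir) :
  reflect (forall b, ~~ p_basis b -> (x : svir_space)@_b = 0) (x \in p_mem).
Proof.
apply: (iffP allP) => [hx b nb|hx b].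
  by apply: mcoeff_outdom; apply: contra nb; exact: hx.
by apply: contraTT => /hx h0; rewrite -mcoeff_eq0 h0.
Qed.

Fact p_mem_submod : GRing.submod_closed p_mem.
Proof.
split=> [|a x y /p_memP hx /p_memP hy].
  by apply/p_memP => b _; rewrite mcoeff0.
by apply/p_memP => b nb; rewrite mcoeffD mcoeffZ hx // hy // mulr0 addr0.
Qed.

Lemma p_mem_basis b : p_basis b -> (<< b >> : svir) \in p_mem.
Proof.
move=> hb; apply/p_memP => d nd; rewrite mcoeffU; case: eqP => // E.
by rewrite -E hb in nd.
Qed.

Lemma p_mem_ind (P : svir_space -> Prop) :
  P 0 -> (forall a x y, P x -> P y -> P (a *: x + y)) ->
  (forall b, p_basis b -> P << b >>) -> forall x, x \in p_mem -> P x.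
Proof.
move=> P0 PD Pb x /p_memP hx; rewrite [x : svir_space]monalgE.
elim/big_ind: _ => // [y z Py Pz|b _].
  by rewrite -[y]scale1r; exact: PD.
have [hb|/hx ->] := boolP (p_basis b); last by rewrite monalgU0.
have -> : << x@_b *g b >> = x@_b *: (<< b >> : svir_space).
  by apply/malgP => k; rewrite mcoeffZ !mcoeffU mulrnAr mulr1.
by rewrite -[_ *: _]addr0; apply: PD => //; exact: Pb.
Qed.

Let p_memD a x y : x \in p_mem -> y \in p_mem -> a *: x + y \in p_mem.
Proof. exact: p_mem_submod.2. Qed.
Let p_mem0 : 0 \in p_mem. Proof. exact: p_mem_submod.1. Qed.
Let p_memZ a x : x \in p_mem -> a *: x \in p_mem.
Proof. by move=> hx; rewrite -[_ *: _]addr0; exact: p_memD. Qed.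

Fact p_mem_component p x : x \in p_mem -> component p x \in p_mem.
Proof.
move: x; apply: p_mem_ind => [|a x y hx hy|b hb]; first by rewrite linear0.
  by rewrite linearP; exact: p_memD.
rewrite [component p _]extendU; case: ifP => // _; exact: p_mem_basis.
Qed.

Fact p_mem_bracket x y : x \in p_mem -> y \in p_mem -> bracket x y \in p_mem.
Proof.
move=> hx hy; move: x hx; apply: p_mem_ind => [|c x x' hx hx'|a ha].
- by rewrite [bracket _ _]svir_bracket0l.
- by rewrite [bracket _ _]svir_bracketDl svir_bracketZl; exact: p_memD.
move: y hy; apply: p_mem_ind => [|c y y' hy hy'|b hb].
- by rewrite [bracket _ _]svir_bracket0r.
- by rewrite [bracket _ _]svir_bracketDr svir_bracketZr; exact: p_memD.
rewrite [bracket _ _]svir_bracketU.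
case: a b ha hb => [m|k|] [n|l|] //=; move=> ha hb.
- have -> : (m + n == 0) = false by lia.
  by apply: p_memD; [apply: p_mem_basis => /=; lia | rewrite scale0r].
- by apply: p_memZ; apply: p_mem_basis => /=; lia.
- by rewrite -scaleNr; apply: p_memZ; apply: p_mem_basis => /=; lia.
- have -> : (k + l + h%:Z == 0) = false by lia.
  by apply: p_memD; [apply: p_mem_basis => /=; lia | rewrite scale0r].
Qed.

Definition p_sub : lieSub svir := LieSub p_mem_submod p_mem_component p_mem_bracket.
Definition pLie : lieSuperalgebra K := subLie p_sub.

Definition pL (n : int) (n1 : 1 <= n) : pLie :=
  Sub (svirL n) (@p_mem_basis (BL n) n1).

Definition pL2 : pLie := @pL 2 isT.

(* p_epsilon (+) K C, as an external direct sum mapped isomorphically onto the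
   subalgebra of svir by pc_inclusion. *)
Definition pcLie : lieSuperalgebra K := sumLie pLie (lineLie K).

Definition pc_incl (x : pcLie) : svir := val x.1 + (x.2 : K) *: svirC.

Fact pc_incl_linear : linear pc_incl.
Proof.
move=> a x y; rewrite /pc_incl /= scalerDl -scalerA scalerDr -!addrA.
by congr (_ + _); rewrite addrCA.
Qed.

Fact pc_incl_component p x : pc_incl (component p x) = component p (pc_incl x).
Proof.
have hC : component p svirC = if p == false then svirC else 0.
  exact: (homogE p (basis_homog BC)).
have -> : component p (pc_incl x) =
    component p (val x.1) + (x.2 : K) *: component p svirC.
  by rewrite /pc_incl linearD linearZZ.
rewrite hC /pc_incl.
by case: p {hC} => //=; rewrite scale0r scaler0.
Qed.

Fact pc_incl_bracket x y :
  pc_incl (bracket x y) = bracket (pc_incl x) (pc_incl y).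
Proof.
rewrite /pc_incl /= scale0r addr0 !(svir_bracketDl, svir_bracketDr).
rewrite !(svir_bracketZl, svir_bracketZr) !svir_bracketCl !svir_bracketCr.
by rewrite !scaler0 !addr0.
Qed.

Definition pc_inclusion : lieHom pcLie svir :=
  LieHom pc_incl_linear pc_incl_component pc_incl_bracket.

Section Whittaker.
Variables (psi : lieHom pLie (lineLie K)) (c : K).

Definition pc_char (x : pcLie) : lineLie K := psi x.1 + (x.2 : K) * c.

Fact pc_char_linear : linear pc_char.
Proof.
move=> a x y; rewrite /pc_char linearP.
set u : K := psi x.1; set v : K := psi y.1.
change (a * u + v + (a * x.2 + y.2) * c = a * (u + x.2 * c) + (v + y.2 * c) :> K).
by ring.
Qed.

Fact pc_char_component p x : pc_char (component p x) = component p (pc_char x).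
Proof.
rewrite /pc_char /= lie_fun_component; case: p => //=.
by rewrite /line_component mul0r addr0.
Qed.

Fact pc_char_bracket x y : pc_char (bracket x y) = bracket (pc_char x) (pc_char y).
Proof. by rewrite /pc_char /= lie_fun_bracket mul0r addr0. Qed.

Definition pc_character : lieHom pcLie (lineLie K) :=
  LieHom pc_char_linear pc_char_component pc_char_bracket.

(* W_epsilon(psi, c): x w = psi(x) w for x in p_epsilon, and C w = c w. *)
Definition Wmodule : lieModule svir :=
  indModule pc_inclusion (lineModule pc_character).

End Whittaker.
End SVir.

(* Main.v *)
Require Import Defs.
From HB Require Import structures.
From mathcomp Require Import all_boot all_order all_algebra ssrAC.
From mathcomp Require Import boolp reals complex finmap monalg ring zify.

Set Implicit Arguments.
Unset Strict Implicit.
Unset Printing Implicit Defensive.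

Import Order.TTheory GRing.Theory Num.Theory.

Local Open Scope ring_scope.

(** Write p for p_epsilon and w for the generator of W, so that x w = psi(x) w
    for x in p. The character psi is even and kills brackets, hence it vanishes
    on every G_r and, L_n being a multiple of [L_1, L_(n-1)], on every L_n with
    n >= 3: it is determined by psi(L_1) and psi(L_2). Let d be the largest
    index in {1, 2} with psi(L_d) <> 0.

    Simplicity. Call creation letters the L_m with m <= 0 and the G_r with
    r <= T, where T = 1 - epsilon; W is spanned by the words in creation letters
    applied to w. Give the letter of index r the degree d - r. A bracket of
    letters of indices r and s has index r + s, so it lowers the total degree
    by d, and by induction on the length of words x - psi(x) lowers the degree
    by r when x in p has index r (filt_defect). Up to terms of lower degree the
    letters supercommute, so every vector has a symbol: a combination of normal
    words of the same degree (symbol_exists). Let b be the largest letter of the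
    symbol, that is the one of least index, and x the letter of index d minus
    that of b. Then [x, b] is a nonzero multiple of L_d, while [x, j] lies in p
    and is killed by psi for every smaller letter j. Hence x - psi(x) acts on
    symbols as a nonzero multiple of the derivative in b (lead_term), and
    repeating this leads from any nonzero vector of a submodule to w. One letter
    is left over: for d = 2T the partner of G_T is G_T itself, which is not in
    p. There a vector a G_T w + a' w is reached, the grading isolates G_T w, and
    G_T (G_T w) = L_d w = psi(L_d) w. The choice d = 2 is always possible when
    psi(L_2) <> 0; d = 1 requires epsilon = 1/2, since for epsilon = 0 the
    letter G_1 would have degree 0.

    The symbol is treated as a formal expression, so this argument needs no
    linear independence of the words in W: it only remains to know that w <> 0.

    Existence. Let N be a set of letters whose complement spans a subalgebra
    carrying a character chi. The space freely spanned by the normal words in N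
    carries an action of SVir in which the empty word spans the module of chi;
    this is the Poincare-Birkhoff-Witt theorem for the induced module, and it is
    proved by letting a letter act through its straightened products
    (model_bracket). With N the creation letters it gives a map from W that
    sends w to the empty word (wvec_map), so w <> 0.

    Failure of simplicity. If epsilon = 0 and psi(L_2) = 0, then psi extends by
    zero to p + C G_1, because G_1^2 = L_2. The model for the creation letters
    other than G_1 is then a quotient of W in which w survives and G_1 w dies,
    whereas G_1 w <> 0 in W by the first model. So the graded kernel of this
    quotient map is a proper nonzero submodule (not_simple). *)

(** * Linear algebra in free modules *)

Lemma seq_argmax (T : eqType) (f : T -> int) (s : seq T) : s != [::] ->
  exists2 x, x \in s & forall y, y \in s -> f y <= f x.
Proof.
elim: s => // x s IH _; have [->|/IH [y ys ymax]] := eqVneq s [::].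
  by exists x; rewrite ?mem_head // => y; rewrite inE => /eqP ->.
have [xy|yx] := leP (f x) (f y).
  exists y; first by rewrite inE ys orbT.
  by move=> z; rewrite inE => /orP[/eqP->|/ymax].
exists x; first exact: mem_head.
move=> z; rewrite inE => /orP[/eqP->//|/ymax zy].
exact: le_trans zy (ltW yx).
Qed.

Lemma linear_at0 (K : numFieldType) (U V : lmodType K) (f : U -> V) :
  linear f -> f 0 = 0.
Proof. by move=> fl; have := fl (-1) 0 0; rewrite scaler0 addr0 scaleN1r addNr. Qed.

Lemma eq_opp0 (K : numFieldType) (V : lmodType K) (v : V) : v = - v -> v = 0.
Proof.
move=> E; have v2 : 2 *: v = 0 by rewrite scaler_nat mulr2n {1}E addNr.
have n2 : (2 : K) != 0 by rewrite pnatr_eq0.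
by rewrite -[v]scale1r -(mulVf n2) -scalerA v2 scaler0.
Qed.

Lemma eq_opp2_0 (K : numFieldType) (V : lmodType K) (v : V) : v = - v - v -> v = 0.
Proof.
move=> E; have v3 : 3 *: v = 0.
  by rewrite scaler_nat mulrSr mulr2n {3}E [- v - v]addrC addrA addrK subrr.
have n3 : (3 : K) != 0 by rewrite pnatr_eq0.
by rewrite -[v]scale1r -(mulVf n3) -scalerA v3 scaler0.
Qed.

Lemma double_half (K : numFieldType) (V : lmodType K) (v w : V) :
  v = 2^-1 *: w <-> v = w - v.
Proof.
have n2 : (2 : K) != 0 by rewrite pnatr_eq0.
have E : 2^-1 *: w + 2^-1 *: w = w.
  by rewrite -scalerDl -[RHS]scale1r; congr (_ *: _); field.
split=> [->|e]; first by rewrite -{2}E addrK.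
have v2 : 2 *: v = w by rewrite scaler_nat mulr2n {1}e subrK.
by rewrite -v2 scalerA mulVf // scale1r.
Qed.

(** The bookkeeping of signs in commutes_through; a, b, c stand for the signs of
    the pairs (x, y), (x, j), (y, j). *)
Lemma swap_terms (K : fieldType) (V : lmodType K) (v1 v2 v3 v4 v5 v6 : V)
    (a b c : K) : a * a = 1 ->
  (v1 + a *: v2 + (a * b) *: v3) + c *: (v4 + b *: (v5 + a *: v6)) =
  (v1 + (b * c) *: v5) + a *: ((v2 + (a * c) *: v4) + b *: (v3 + c *: v6)).
Proof.
move=> aa; rewrite !scalerDr !scalerA [a * (a * c)]mulrA aa mul1r.
rewrite [a * b * c]mulrAC [c * b * a]mulrAC [c * a]mulrC [b * c]mulrC !addrA.
by rewrite [LHS](AC 6 (1*5*2*4*3*6)).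
Qed.

(** The bookkeeping of signs in commutes_through_square. *)
Lemma square_terms (K : numFieldType) (V : lmodType K) (t u v w : V) (s : K) :
  s * s = 1 -> w = 2^-1 *: v ->
  2^-1 *: (2 *: t + v) = (t + (- s) *: u) + s *: (u + s *: w).
Proof.
move=> ss ->; rewrite !scalerDr !scalerA ss mul1r mulVf ?pnatr_eq0 // scale1r.
by rewrite scaleNr addrA subrK.
Qed.

Fact mlin_key : unit. Proof. exact: tt. Qed.
Definition mlin (K : numFieldType) (I : choiceType) (V : lmodType K) (F : I -> V) :=
  locked_with mlin_key (fun x : {malg K[I]} => \sum_(i <- msupp x) x@_i *: F i).

Section LinearSpan.
Variable K : numFieldType.

(** The linear span of S, as a predicate generated by linear combinations so that
    statements about spans are proved by induction. *)
Inductive lspan (V : lmodType K) (S : V -> Prop) : V -> Prop :=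
| lspan0 : lspan S 0
| lspanP a u v : lspan S u -> lspan S v -> lspan S (a *: u + v)
| lspan_gen v : S v -> lspan S v.

Section Closure.
Variables (V : lmodType K) (S : V -> Prop).

Lemma lspanZ a v : lspan S v -> lspan S (a *: v).
Proof. by move=> hv; rewrite -[_ *: _]addr0; apply: lspanP => //; exact: lspan0. Qed.

Lemma lspanD u v : lspan S u -> lspan S v -> lspan S (u + v).
Proof. by move=> hu hv; rewrite -[u]scale1r; exact: lspanP. Qed.

Lemma lspan_sum (I : eqType) (r : seq I) (F : I -> V) :
  (forall i, i \in r -> lspan S (F i)) -> lspan S (\sum_(i <- r) F i).
Proof.
by move=> hF; rewrite big_seq; elim/big_ind: _ => //; [exact: lspan0 | exact: lspanD].
Qed.

Lemma lspanN v : lspan S v -> lspan S (- v).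
Proof. by rewrite -scaleN1r; exact: lspanZ. Qed.

Lemma lspan_image (W : lmodType K) (T : W -> Prop) (f : {linear V -> W}) :
  (forall v, S v -> lspan T (f v)) -> forall v, lspan S v -> lspan T (f v).
Proof.
move=> hf v; elim=> [|a u u' _ hu _ hu'|u /hf //]; first by rewrite linear0; exact: lspan0.
by rewrite linearP; exact: lspanP.
Qed.

End Closure.

Lemma lspan_mono (V : lmodType K) (S T : V -> Prop) :
  (forall v, S v -> T v) -> forall v, lspan S v -> lspan T v.
Proof.
move=> hST v; elim=> [|a u u' _ hu _ hu'|u /hST]; [exact: lspan0|exact: lspanP|exact: lspan_gen].
Qed.

Section FreeModule.
Variables (I : choiceType) (V : lmodType K).
Implicit Types (F : I -> V) (x : {malg K[I]}).

Lemma mlinE F x : mlin F x = \sum_(i <- msupp x) x@_i *: F i.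
Proof. by rewrite /mlin unlock. Qed.

Lemma mlinEw F (d : {fset I}) x :
  (msupp x `<=` d)%fset -> mlin F x = \sum_(i <- d) x@_i *: F i.
Proof.
move=> sxd; rewrite mlinE (big_fset_incl _ sxd) // => i _ /mcoeff_outdom ->.
by rewrite scale0r.
Qed.

Fact mlin_linear F : linear (mlin F).
Proof.
move=> a x y; pose d := (msupp x `|` msupp y)%fset.
have sx : (msupp x `<=` d)%fset by exact: fsubsetUl.
have sy : (msupp y `<=` d)%fset by exact: fsubsetUr.
rewrite (mlinEw F sx) (mlinEw F sy) (@mlinEw F d).
  rewrite scaler_sumr -big_split /=; apply: eq_bigr => i _.
  by rewrite mcoeffD mcoeffZ scalerDl scalerA.
apply: fsubset_trans (msuppD_le _ _) _; rewrite fsubUset sy andbT.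
exact: fsubset_trans (msuppZ_le _ _) sx.
Qed.
HB.instance Definition _ F :=
  GRing.isLinear.Build K {malg K[I]} V *:%R (mlin F) (mlin_linear F).

Lemma mlin0 F : mlin F 0 = 0. Proof. exact: linear0. Qed.
Lemma mlinD F x y : mlin F (x + y) = mlin F x + mlin F y.
Proof. exact: linearD. Qed.
Lemma mlinB F x y : mlin F (x - y) = mlin F x - mlin F y.
Proof. exact: linearB. Qed.
Lemma mlinZ F a x : mlin F (a *: x) = a *: mlin F x.
Proof. exact: linearZZ. Qed.

Lemma mlinU F i : mlin F << i >> = F i.
Proof. by rewrite (mlinEw F (msuppU_le (x := 1))) big_seq_fset1 mcoeffUU scale1r. Qed.

Lemma mlin_peel F a i x : mlin F x = mlin F (x - a *: << i >>) + a *: F i.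
Proof. by rewrite mlinB mlinZ mlinU subrK. Qed.

End FreeModule.

Definition supported (I : choiceType) (S : I -> Prop) : {malg K[I]} -> Prop :=
  lspan (fun y => exists2 i, S i & y = << i >>).

Lemma malgUZ (I : choiceType) (a : K) (i : I) : << a *g i >> = a *: << i >>.
Proof. by apply/malgP => k; rewrite mcoeffZ !mcoeffU mulrnAr mulr1. Qed.

Lemma malg_ind (I : choiceType) (P : {malg K[I]} -> Prop) :
  P 0 -> (forall a x y, P x -> P y -> P (a *: x + y)) ->
  (forall i, P << i >>) -> forall x, P x.
Proof.
move=> P0 PD Pb x; rewrite [x]monalgE; elim/big_ind: _ => // [y z Py Pz|b _].
  by rewrite -[y]scale1r; exact: PD.
by rewrite malgUZ -[_ *: _]addr0; exact: PD.
Qed.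

Lemma mlin_eq_span (I : choiceType) (V : lmodType K) (S : I -> Prop) (F F' : I -> V) x :
  (forall i, S i -> F i = F' i) ->
  supported S x ->
  mlin F x = mlin F' x.
Proof.
move=> e; elim=> [|a u v _ hu _ hv|_ [i /e ei ->]]; first by rewrite !mlin0.
  by rewrite !mlinD !mlinZ hu hv.
by rewrite !mlinU.
Qed.

(** Two linear maps agree on a vector as soon as they agree on one distinguished
    term and on all the remaining terms. This is how straightened products, known
    up to shorter words, are compared. *)
Lemma mlin_eq_lead (I : choiceType) (V : lmodType K) (S : I -> Prop) (F F' : I -> V)
    c i x :
  supported S (x - c *: << i >>) ->
  (forall i, S i -> F i = F' i) -> c *: F i = c *: F' i -> mlin F x = mlin F' x.
Proof.
move=> hx eS ei; rewrite (mlin_peel F c i) (mlin_peel F' c i) ei.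
by rewrite (mlin_eq_span eS hx).
Qed.

End LinearSpan.

(** * Normal words *)

Section NormalWords.
Variables (h : bool) (N : pred basis).

(** Minus four times the index, increased by 1 on odd letters: letters of lower
    index have higher rank, and when L_m and G_m have the same index the odd one
    wins. The value at C only has to differ from the others. *)
Definition rank (b : basis) : int :=
  match b with BL m => - 4 * m | BG k => - 4 * k - 2 * h%:Z + 1 | BC => 2 end.

Lemma rank_inj : injective rank.
Proof. by case=> [m|m|] [n|n|] /= e; try (congr (_ _)); try done; lia. Qed.

(** Letters are written in weakly decreasing rank; an odd letter may not be
    repeated, as its square is half of a bracket. *)
Definition precedes (x y : basis) : bool :=
  (rank y < rank x) || (x == y) && ~~ basis_parity x.

Lemma precedes_refl x : precedes x x = ~~ basis_parity x.
Proof. by rewrite /precedes ltxx eqxx. Qed.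

Lemma precedes_trans : transitive precedes.
Proof.
move=> y x z /orP[lyx|/andP[/eqP-> _]] // /orP[lzy|/andP[/eqP<- _]].
  by rewrite /precedes (lt_trans lzy lyx).
by rewrite /precedes lyx.
Qed.

Lemma precedes_total x y : x != y -> ~~ precedes x y -> precedes y x.
Proof.
rewrite /precedes; move=> nxy; rewrite (negbTE nxy) orbF -leNgt le_eqVlt.
by case/orP=> [/eqP/rank_inj e|->//]; rewrite e eqxx in nxy.
Qed.

Definition normal (s : seq basis) := all N s && sorted precedes s.

Lemma normal_cons x s : normal (x :: s) = [&& N x, all (precedes x) s & normal s].
Proof.
rewrite /normal /= (path_sortedE precedes_trans).
by case: (N x) => //=; case: (all N s) => //=; rewrite ?andbF.
Qed.

Lemma precedes_blocked x j s : N x -> normal (j :: s) -> ~~ normal (x :: j :: s) ->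
  x != j -> precedes j x.
Proof.
move=> Nx njs nn xj; apply: precedes_total => //; apply: contra nn => pxj.
rewrite normal_cons Nx njs /= pxj /= andbT.
move: njs; rewrite normal_cons => /and3P[_ js _].
by apply: sub_all js => y; exact: precedes_trans.
Qed.

Lemma normal_behead j s : normal (j :: s) -> normal s.
Proof. by rewrite normal_cons => /and3P[]. Qed.

(** If x cannot be written in front of j s, then j can be written in front of any
    rearrangement of x s: moving x past j does not obstruct j. *)
Lemma normal_front x j s t : normal (j :: s) -> ~~ normal (x :: j :: s) -> x != j ->
  perm_eq t (x :: s) -> normal t -> normal (j :: t).
Proof.
move=> njs nn xj pt nt.
have Nx : N x.
  have: all N t by case/andP: nt.
  by move/allP; apply; rewrite (perm_mem pt) inE eqxx.
have pjx := precedes_blocked Nx njs nn xj.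
move: njs; rewrite normal_cons => /and3P[Nj js ns].
by rewrite normal_cons Nj nt (perm_all _ pt) /= pjx js.
Qed.

Lemma normal_repeat j s : normal (j :: s) -> ~~ normal (j :: j :: s) -> basis_parity j.
Proof.
move=> njs nn; apply: contraNT nn => pj; rewrite normal_cons njs /= precedes_refl pj.
by move: njs; rewrite normal_cons => /and3P[-> -> _].
Qed.

End NormalWords.

(** Together with C and p_epsilon, the creation letters span the algebra. *)
Definition creation (h : bool) (b : basis) : bool :=
  match b with BL m => m <= 0 | BG k => k + h%:Z <= 1 | BC => false end.

Lemma creation_spec h b : ~~ creation h b -> p_basis h b \/ b = BC.
Proof. by case: b => [m|k|] /= nb; [left; lia|left; lia|by right]. Qed.

(** * The commutation relation on one vector *)

Section Commutation.
Variables (K : numFieldType) (h : bool).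

Local Notation g := (svir K h).
Local Notation e b := (<< b >> : svir_space K).
Local Notation par := basis_parity.
Local Notation sgn x y := ((-1) ^+ (basis_parity x && basis_parity y) : K).
Local Notation br x y := (svir_bracket h (e x) (e y)).

Lemma sgn_sq (p : bool) : (-1) ^+ p * (-1) ^+ p = 1 :> K.
Proof. by rewrite -signr_addb addbb. Qed.

Variables (V : lmodType K) (rho : g -> V -> V).
Hypothesis rho_linearl : forall v, linear (rho^~ v).
Hypothesis rho_linearr : forall u, linear (rho u).

Let rhol v u := rho u v.
HB.instance Definition _ v := GRing.isLinear.Build K g V *:%R (rhol v) (rho_linearl v).
HB.instance Definition _ u := GRing.isLinear.Build K V V *:%R (rho u) (rho_linearr u).

Lemma rhoDl u u' v : rho (u + u') v = rho u v + rho u' v.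
Proof. exact: (linearD (rhol v)). Qed.
Lemma rho0l v : rho 0 v = 0. Proof. exact: linear_at0 (rho_linearl v). Qed.
Lemma rhoZl a u v : rho (a *: u) v = a *: rho u v.
Proof. exact: (linearZZ (rhol v)). Qed.
Lemma rhoNl u v : rho (- u) v = - rho u v.
Proof. exact: (linearN (rhol v)). Qed.
Lemma rho_rDZ u a v w : rho u (a *: v + w) = a *: rho u v + rho u w.
Proof. exact: rho_linearr. Qed.
Lemma rho_r0 u : rho u 0 = 0. Proof. exact: linear0. Qed.
Lemma rho_rD u v w : rho u (v + w) = rho u v + rho u w.
Proof. exact: linearD. Qed.
Lemma rho_rZ u a v : rho u (a *: v) = a *: rho u v.
Proof. exact: linearZZ. Qed.

(** The defining relation of a module, for one pair of elements and one vector, so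
    that it can be established vector by vector. *)
Definition commutes p q (u u' : g) v := rho u (rho u' v) =
  rho (svir_bracket h u u') v + (-1) ^+ (p && q) *: rho u' (rho u v).

Lemma commutes_span p q u u' S v : (forall w, S w -> commutes p q u u' w) ->
  lspan S v -> commutes p q u u' v.
Proof.
rewrite /commutes => hS; elim=> [|a v1 v2 _ h1 _ h2|w /hS //].
  by rewrite !rho_r0 scaler0 addr0.
rewrite !rho_rDZ h1 h2 !scalerDr !scalerA [a * _]mulrC.
by rewrite addrACA.
Qed.

Lemma commutes_sym p q u u' v : u \in homog p -> u' \in homog q ->
  commutes p q u u' v -> commutes q p u' u v.
Proof.
rewrite /commutes => hu hu' ->; rewrite (svir_bracket_skew h hu' hu) rhoNl rhoZl.
rewrite [p && q]andbC scalerDr scalerA -signr_addb addbb scale1r.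
by rewrite addrA addNr add0r.
Qed.

Lemma commutes_homog v : (forall x y, commutes (par x) (par y) (e x) (e y) v) ->
  forall p q (u u' : g), u \in homog p -> u' \in homog q -> commutes p q u u' v.
Proof.
move=> hv p q u u' hu hu'; move: u hu.
apply: svir_homog_ind => [|a x y hx hy|x <-].
- by rewrite /commutes svir_bracket0l !rho0l rho_r0 scaler0 addr0.
- move: hx hy; rewrite /commutes svir_bracketDl svir_bracketZl.
  rewrite !(rhoDl, rhoZl) rho_rD rho_rZ => -> ->.
  by rewrite !scalerDr !scalerA [a * _]mulrC addrACA.
move: u' hu'; apply: svir_homog_ind => [|a y y' hx hy|y <-]; last exact: hv.
- by rewrite /commutes svir_bracket0r !rho0l rho_r0 scaler0 addr0.
- move: hx hy; rewrite /commutes svir_bracketDr svir_bracketZr.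
  rewrite !(rhoDl, rhoZl) rho_rD rho_rZ => -> ->.
  by rewrite !scalerDr !scalerA [a * _]mulrC addrACA.
Qed.

Local Notation cm x y v := (commutes (par x) (par y) (e x) (e y) v).

Lemma commutes_sym_letter x y v : cm x y v -> cm y x v.
Proof. by apply: commutes_sym; exact: (basis_homog K). Qed.

Lemma bracket_even x : ~~ par x -> br x x = 0.
Proof.
move=> ex; have hx := basis_homog K x.
apply: (@eq_opp0 K (svir_space K)).
by rewrite {1}(svir_bracket_skew h hx hx) (negbTE ex) scale1r.
Qed.

Lemma odd_half j (u v : V) : par j -> u = v + sgn j j *: u -> u = 2^-1 *: v.
Proof. by move=> oj; rewrite oj expr1 scaleN1r => e; apply/double_half. Qed.

Lemma jacobi x y j : svir_bracket h (e x) (br y j) =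
  svir_bracket h (br x y) (e j) + sgn x y *: svir_bracket h (e y) (br x j).
Proof. by apply: svir_bracket_jacobi; exact: basis_homog. Qed.

Lemma br_homog x y : br x y \in @homog _ g (par x (+) par y).
Proof. by apply: svir_bracket_homog; exact: basis_homog. Qed.

Section Step.
Variables (x y j : basis) (z : V).
Hypothesis cz : forall a b, cm a b z.

Let cH := commutes_homog cz.
Let hB b := basis_homog K b.

(** This is the Jacobi identity: if all pairs commute on z, then x and y commute on
    j z provided that x and y commute with j on the two vectors produced when
    they are moved past j. *)
Lemma commutes_through : cm x j (rho (e y) z) -> cm y j (rho (e x) z) ->
  cm x y (rho (e j) z).
Proof.
have Jac := jacobi x y j.
have := cH (br_homog x y) (hB j).
have := cH (hB y) (br_homog x j); have := cH (hB x) (br_homog y j).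
have := cz x y; have := cz x j; have := cz y j.
rewrite /commutes !andb_addr andb_addl !signr_addb [par y && par x]andbC.
move: Jac.
move: (svir_bracket h _ (br x j)) (svir_bracket h _ (br y j))
  (svir_bracket h (br x y) _) => y_xj x_yj xy_j.
move: (br x y) (br x j) (br y j) (e x) (e y) (e j) => xy xj yj X Y J.
move=> Jac Eyj Exj Exy E5 E6 E7 E3 E4.
rewrite Eyj Exj !rho_rD !rho_rZ E3 E4 E5 E6 E7 Exy Jac !rho_rD !rho_rZ.
rewrite (rhoDl xy_j) (rhoZl _ y_xj).
by apply: swap_terms; exact: sgn_sq.
Qed.

(** The case y = j of the previous step, where one of its hypotheses is the
    conclusion itself. For odd j it is replaced by j^2 = [j, j] / 2. *)
Lemma commutes_through_square : par j -> cm j j (rho (e x) z) -> cm x j (rho (e j) z).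
Proof.
move=> oj.
have hjj := br_homog j j; have hxj := br_homog x j.
have Jac : svir_bracket h (e x) (br j j) = 2 *: svir_bracket h (br x j) (e j).
  rewrite (jacobi x j j) (svir_bracket_skew h (hB j) hxj) oj andbT addbT.
  by rewrite signrN scaleNr opprK scalerA sgn_sq scale1r scaler_nat mulr2n.
move: Jac; have := cz x j; have := cz j j.
have := cH hxj (hB j); have := cH (hB x) hjj.
rewrite /commutes addbb andbF expr0 oj !andbT addbT signrN scale1r expr1 !scaleN1r.
move: (svir_bracket h _ (br j j)) (svir_bracket h (br x j) _) => x_jj xj_j.
move: (br x j) (br j j) (e x) (e j) => xj jj X J.
move=> E1 E2 /double_half E3 E4 Jac /double_half E5.
rewrite E3 rho_rZ E1 Jac rhoZl E2 E4 !rho_rD !rho_rZ.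
by apply: square_terms; [exact: sgn_sq | exact: E5].
Qed.

(** The case x = y = j: it amounts to [j, [j, j]] = 0. *)
Lemma commutes_cube : par j -> cm j j (rho (e j) z).
Proof.
move=> oj; rewrite /commutes oj expr1 scaleN1r; apply/double_half.
have sgnjj (u v : V) : u = v + sgn j j *: u -> u = 2^-1 *: v by exact: odd_half.
have hjj := br_homog j j.
rewrite (sgnjj _ _ (cz j j)) rho_rZ (cH (hB j) hjj) addbb andbF expr0 scale1r.
suff -> : svir_bracket h (e j) (br j j) = 0 by rewrite rho0l add0r.
apply: (@eq_opp2_0 K (svir_space K)).
rewrite {1}(jacobi j j j) (svir_bracket_skew h hjj (hB j)) addbb andFb expr0 scale1r.
by rewrite oj expr1 scaleN1r.
Qed.

End Step.

End Commutation.

(** * The action on normal words *)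

Section InducedModel.
Variables (K : numFieldType) (h : bool) (N : pred basis) (chi : basis -> K).

Local Notation g := (svir K h).
Local Notation e b := (<< b >> : svir_space K).
Local Notation V := {malg K[seq basis]}.
Local Notation normal := (normal h N).
Local Notation sgn x y := ((-1) ^+ (basis_parity x && basis_parity y) : K).
Local Notation br x y := (svir_bracket h (e x) (e y)).

(** The product of the letter x and the normal word s, written as a combination of
    normal words: x is moved past the first letter j of s by the commutation
    relation, and letters outside N that reach the end act by chi. The number n
    only bounds the depth of the recursion; any n larger than the length of s
    gives the same value (straighten_stable). *)
Fixpoint straighten_rec (n : nat) (x : basis) (s : seq basis) : V :=
  if n isn't m.+1 then 0 else
  if normal (x :: s) then << x :: s >> else
  if s isn't j :: t then chi x *: << [::] >> else
  if x == j then 2^-1 *: mlin (fun a => straighten_rec m a t) (br x j) else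
  mlin (fun a => straighten_rec m a t) (br x j) +
    sgn x j *: mlin (straighten_rec m j) (straighten_rec m x t).

Fact straighten_key : unit. Proof. exact: tt. Qed.
Definition straighten := locked_with straighten_key straighten_rec.

Lemma straightenS m x s : straighten m.+1 x s =
  if normal (x :: s) then << x :: s >> else
  if s isn't j :: t then chi x *: << [::] >> else
  if x == j then 2^-1 *: mlin (fun a => straighten m a t) (br x j) else
  mlin (fun a => straighten m a t) (br x j) +
    sgn x j *: mlin (straighten m j) (straighten m x t).
Proof. by rewrite /straighten unlock. Qed.

Definition short (m : nat) : V -> Prop :=
  supported (fun s => normal s && (size s <= m)%N).

Lemma short_word m s : normal s -> (size s <= m)%N -> short m << s >>.
Proof. by move=> ns sm; apply: lspan_gen; exists s; rewrite ?ns. Qed.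

Lemma short_mono m n v : (m <= n)%N -> short m v -> short n v.
Proof.
move=> mn; apply: lspan_mono => _ [s /andP[ns sm] ->].
by exists s; rewrite ?ns ?(leq_trans sm).
Qed.

(** The product x s has at most one term of length 1 + |s|, a rearrangement t of
    x s; the case c = 0 occurs when x is not in N or the rearrangement repeats an
    odd letter. *)
Definition lead_spec x s v := exists c t,
  [/\ perm_eq t (x :: s), c = 0 \/ normal t & short (size s) (v - c *: << t >>)].

Lemma lead_short x s v : lead_spec x s v -> short (size s).+1 v.
Proof.
case=> c [t [pt nt sv]]; rewrite -[v](subrK (c *: << t >>)); apply: lspanD.
  exact: short_mono sv.
case: nt => [->|nt]; first by rewrite scale0r; exact: lspan0.
by apply/lspanZ/short_word => //; rewrite (perm_size pt).
Qed.

Lemma straighten_lead n s : normal s -> (size s < n)%N ->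
  forall x, lead_spec x s (straighten n x s).
Proof.
elim: n s => [|n IH] s ns sn x //; rewrite straightenS.
case: ifP => [nxs|/negbT nn].
  exists 1, (x :: s); split; [exact: perm_refl|by right|].
  by rewrite scale1r subrr; exact: lspan0.
case: s ns sn nn => [|j t] ns sn nn.
  exists 0, [:: x]; split; [exact: perm_refl|by left|].
  by rewrite scale0r subr0; apply/lspanZ/short_word.
have nt := normal_behead ns.
have tn : (size t < n)%N by [].
have sB u : short (size t).+1 (mlin (fun a => straighten n a t) u).
  by rewrite mlinE; apply: lspan_sum => a _; apply/lspanZ/lead_short/IH.
case: eqP => [_|/eqP xj].
  exists 0, [:: x, j & t]; split; [exact: perm_refl|by left|].
  by rewrite scale0r subr0; apply/lspanZ/sB.
have [c [s' [ps' ns' low]]] := IH t nt tn x.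
have sL v : short (size t) v -> short (size t).+1 (mlin (straighten n j) v).
  apply: (@lspan_image _ _ _ _ _ (mlin (straighten n j))) => _ [s /andP[ns1 s1] ->].
  rewrite /= mlinU.
  apply: short_mono (lead_short (IH s ns1 _ j)) => //.
  exact: leq_ltn_trans tn.
(* j is put directly in front of the long term of x t, so that only the shorter
   terms use the recursion *)
have sc : short (size t).+1 (mlin (straighten n j) (straighten n x t)
     - c *: << j :: s' >>).
  have -> : mlin (straighten n j) (straighten n x t) - c *: << j :: s' >> =
      mlin (straighten n j) (straighten n x t - c *: << s' >>) +
      c *: (straighten n j s' - << j :: s' >>).
    by rewrite (mlin_peel _ c s') scalerBr addrA.
  apply: lspanD; first exact: sL.
  case: ns' => [->|ns']; first by rewrite scale0r; exact: lspan0.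
  have -> : straighten n j s' = << j :: s' >>.
    by case: (n) tn => // m _; rewrite straightenS (normal_front ns nn xj ps' ns').
  by rewrite subrr scaler0; exact: lspan0.
exists (sgn x j * c), (j :: s'); split.
- apply: (@perm_trans _ (j :: x :: t)); first by rewrite perm_cons.
  by rewrite -(cat1s j) -(cat1s x) perm_catCA.
- case: ns' => [->|ns']; first by rewrite mulr0; left.
  by right; exact: normal_front ps' ns'.
- by rewrite -scalerA -addrA -scalerBr; apply: lspanD; [exact: sB|exact: lspanZ].
Qed.

Lemma straighten_stable n m s x : normal s -> (size s < n)%N -> (size s < m)%N ->
  straighten n x s = straighten m x s.
Proof.
elim: n m s x => [|n IH] m s x ns; first by rewrite ltn0.
case: m => [|m] sn sm; first by rewrite ltn0 in sm.
rewrite !straightenS.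
have [//|nn] := boolP (normal (x :: s)).
case: s ns sn sm nn => [//|j t] ns sn sm nn.
have nt := normal_behead ns.
have eB u : mlin (fun a => straighten n a t) u = mlin (fun a => straighten m a t) u.
  by rewrite !mlinE; apply: eq_bigr => a _; rewrite (IH m).
rewrite (eB (br x j)).
have [//|xj] := eqVneq x j.
have -> : straighten n x t = straighten m x t by exact: IH.
congr (_ + _ *: _).
have [c [s' [ps' ns' low]]] := straighten_lead nt sm x.
apply: (mlin_eq_lead low) => [s2|].
  move=> /andP[ns2 ss2]; apply: IH => //; exact: leq_ltn_trans ss2 _.
case: ns' => [->|ns']; first by rewrite !scale0r.
have nj := normal_front ns nn xj ps' ns'.
by case: n m sn sm {IH eB low} => [|n] [|m] // _ _; rewrite !straightenS nj.
Qed.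

(** On words that are not normal every letter acts by zero. This keeps the whole
    free module as carrier: there the commutation relation holds trivially. *)
Definition letter_act (x : basis) (s : seq basis) : V :=
  if normal s then straighten (size s).+1 x s else 0.

Definition model_action (u : g) (v : V) : V := mlin (fun a => mlin (letter_act a) v) u.

Fact model_linearr u : linear (model_action u).
Proof.
move=> a v w; rewrite /model_action !mlinE scaler_sumr -big_split /=.
by apply: eq_bigr => b _; rewrite linearP scalerDr !scalerA mulrC.
Qed.
Fact model_linearl v : linear (model_action^~ v).
Proof. exact: mlin_linear. Qed.

Lemma model_actionU x v : model_action (e x) v = mlin (letter_act x) v.
Proof. by rewrite /model_action mlinU. Qed.

Lemma model_actionUU x s : model_action (e x) << s >> = letter_act x s.
Proof. by rewrite model_actionU mlinU. Qed.

Lemma model_action_word u s : normal s ->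
  model_action u << s >> = mlin (fun a => straighten (size s).+1 a s) u.
Proof.
by move=> ns; rewrite /model_action !mlinE; apply: eq_bigr => a _; rewrite mlinU /letter_act ns.
Qed.

Lemma act_front x s : normal (x :: s) -> model_action (e x) << s >> = << x :: s >>.
Proof. by move=> nxs; rewrite model_actionUU /letter_act (normal_behead nxs) straightenS nxs. Qed.

Lemma act_nil x : ~~ N x -> model_action (e x) << [::] >> = chi x *: << [::] >>.
Proof. by move=> nx; rewrite model_actionUU /letter_act straightenS normal_cons (negbTE nx). Qed.

Lemma act_lead x s : normal s -> lead_spec x s (model_action (e x) << s >>).
Proof. by move=> ns; rewrite model_actionUU /letter_act ns; exact: straighten_lead. Qed.

Lemma act_square x s : normal (x :: s) -> ~~ normal (x :: x :: s) ->
  model_action (e x) << x :: s >> = 2^-1 *: model_action (br x x) << s >>.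
Proof.
move=> nxs nn; have ns := normal_behead nxs.
rewrite model_actionUU /letter_act nxs [size _]/= straightenS (negbTE nn) eqxx.
by rewrite -model_action_word.
Qed.

(** The equation that defines the product, now free of the bound on the depth. *)
Lemma act_swap x j s : normal (j :: s) -> ~~ normal (x :: j :: s) -> x != j ->
  model_action (e x) << j :: s >> =
    model_action (br x j) << s >> + sgn x j *: model_action (e j) (model_action (e x) << s >>).
Proof.
move=> njs nn xj; have ns := normal_behead njs.
rewrite {1}model_actionUU {1}/letter_act njs [size _]/= straightenS (negbTE nn).
rewrite (negbTE xj) -(model_action_word _ ns); congr (_ + _ *: _).
rewrite model_actionUU model_actionU {2}/letter_act ns.
have [c [t [pt nt low]]] := @straighten_lead (size s).+1 s ns (ltnSn _) x.
apply: (mlin_eq_lead low) => [s2|].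
  move=> /andP[ns2 ss2]; rewrite /letter_act ns2.
  by apply: straighten_stable.
case: nt => [->|nt]; first by rewrite !scale0r.
by rewrite /letter_act nt !straightenS (normal_front njs nn xj pt nt).
Qed.

End InducedModel.

(** * The model is a module *)

(** The span of the letters outside N is a subalgebra with character chi exactly
    when the brackets of these letters satisfy in_kernel. *)
Definition in_kernel (K : numFieldType) (N : pred basis) (chi : basis -> K)
    (u : svir_space K) : Prop :=
  supported (fun b => ~~ N b) u /\ mlin (chi : basis -> K^o) u = 0.

Section ModelCommutation.
Variables (K : numFieldType) (h : bool) (N : pred basis) (chi : basis -> K).

Local Notation g := (svir K h).
Local Notation e b := (<< b >> : svir_space K).
Local Notation V := {malg K[seq basis]}.
Local Notation normal := (normal h N).
Local Notation par := basis_parity.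
Local Notation sgn x y := ((-1) ^+ (basis_parity x && basis_parity y) : K).
Local Notation br x y := (svir_bracket h (e x) (e y)).
Local Notation rho := (@model_action K h N chi).
Local Notation cm x y v := (commutes rho (par x) (par y) (e x) (e y) v).

Let rhol : forall v, linear (rho^~ v) := @model_linearl K h N chi.
Let rhor : forall u, linear (rho u) := @model_linearr K h N chi.

(** When y s is normal the relation is how the product was defined, either for x
    in front of y s or for y in front of x s. *)
Lemma commutes_front x y s : normal (y :: s) -> cm x y << s >>.
Proof.
move=> nys; have [nxys|nn] := boolP (normal (x :: y :: s)).
  have := nxys; rewrite normal_cons => /and3P[Nx /= /andP[pxy xs] _].
  have [exy|xy] := eqVneq x y.
    move: pxy; rewrite -exy precedes_refl => px.
    by rewrite /commutes bracket_even // (rho0l rhol) add0r (negbTE px) scale1r.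
  have nxs : normal (x :: s).
    by rewrite normal_cons Nx xs (normal_behead nys).
  have nnyx : ~~ normal (y :: x :: s).
    rewrite normal_cons /= !negb_and; apply/orP; right; apply/orP; left.
    apply/orP; left; apply/negP => pyx.
    have := precedes_trans pyx pxy; have := precedes_trans pxy pyx.
    move: pxy pyx; rewrite /precedes (negbTE xy) eq_sym (negbTE xy) !orbF => l1 l2.
    by have := lt_trans l1 l2; rewrite ltxx.
  apply: (commutes_sym_letter rhol); rewrite /commutes (act_front _ nxs).
  by apply: act_swap => //; rewrite eq_sym.
rewrite /commutes (act_front _ nys).
have [exy|xy] := eqVneq x y; last exact: act_swap.
move: nn; rewrite exy => nn.
have py : par y.
  apply: contraNT nn => py; rewrite normal_cons nys /= precedes_refl py andbT /=.
  move: nys; rewrite normal_cons => /and3P[-> ys _]; exact: ys.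
rewrite (act_front _ nys) py expr1 scaleN1r; apply/double_half; exact: act_square.
Qed.

Hypothesis chi_odd : forall b, par b -> chi b = 0.
Hypothesis chi_bracket : forall x y, ~~ N x -> ~~ N y -> in_kernel N chi (br x y).

(** The empty word spans a copy of the one-dimensional module of chi. *)
Lemma model_vacuum u : supported (fun b => ~~ N b) u ->
  rho u << [::] >> = (mlin (chi : basis -> K^o) u : K) *: << [::] >>.
Proof.
elim=> [|a u1 u2 _ h1 _ h2|_ [b nb ->]].
- by rewrite (rho0l rhol) mlin0 scale0r.
- by rewrite (rhoDl rhol) (rhoZl rhol) h1 h2 mlinD mlinZ scalerDl scalerA.
- by rewrite act_nil // mlinU.
Qed.

Lemma commutes_vacuum x y : cm x y << [::] >>.
Proof.
have n1 b : N b -> normal [:: b] by move=> Nb; rewrite normal_cons Nb.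
have [/n1 Ny|Ny] := boolP (N y); first exact: commutes_front.
have [/n1 Nx|Nx] := boolP (N x).
  by apply: (commutes_sym_letter rhol); exact: commutes_front.
have [sxy chixy] := chi_bracket Nx Ny.
rewrite /commutes (model_vacuum sxy) chixy scale0r add0r.
rewrite (act_nil h chi Nx) (act_nil h chi Ny) !(rho_rZ rhor).
rewrite (act_nil h chi Nx) (act_nil h chi Ny) !scalerA.
suff -> : chi y * chi x = (-1) ^+ (par x && par y) * chi x * chi y by [].
case: (boolP (par x)) => [/chi_odd->|_]; first by rewrite mulr0 mulr0 mul0r.
by rewrite mul1r mulrC.
Qed.

(** Induction on the length. If neither x nor y can be written in front of j t,
    both have to be moved past j, which reduces the relation to t. The auxiliary
    commutation with j on y t is no harder: the long term of y t can be preceded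
    by j, and its other terms are shorter. *)
Lemma commutes_word s : normal s -> forall x y, cm x y << s >>.
Proof.
have [n] := ubnP (size s); elim: n s => // n IH [|j t] sn njt x y.
  exact: commutes_vacuum.
have nt := normal_behead njt.
have tn : (size t < n)%N by [].
have IHt := IH t tn nt.
have [nxjt|nnx] := boolP (normal (x :: j :: t)).
  by apply: (commutes_sym_letter rhol); exact: commutes_front.
have [nyjt|nny] := boolP (normal (y :: j :: t)); first exact: commutes_front.
rewrite -(act_front chi njt).
have ext a b : ~~ normal (b :: j :: t) -> b != j -> cm a j (rho (e b) << t >>).
  move=> nb bj; have [c [s' [ps' ns' low]]] := act_lead chi b nt.
  rewrite -[rho _ _](subrK (c *: << s' >>)).
  apply: (@commutes_span _ _ _ _ rhor _ _ _ _ 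
    (fun v => exists2 s, normal s && (size s <= size t)%N || normal (j :: s) &
                         v = << s >>)).
    move=> _ [s /orP[/andP[ns st]|njs] ->]; last exact: commutes_front.
    by apply: IH => //; exact: leq_ltn_trans tn.
  apply: lspanD; first by apply: lspan_mono low => _ [s ns ->]; exists s; rewrite ?ns.
  case: ns' => [->|ns']; first by rewrite scale0r; exact: lspan0.
  apply/lspanZ/lspan_gen; exists s' => //.
  by rewrite (normal_front njt nb bj ps' ns') orbT.
have jodd := normal_repeat njt.
have [exj|xj] := eqVneq x j; have [eyj|yj] := eqVneq y j.
- rewrite exj eyj; apply: (commutes_cube rhol rhor) => //; apply: jodd.
  by rewrite -{1}exj.
- rewrite exj; apply: (commutes_sym_letter rhol).
  apply: (commutes_through_square rhol rhor) => //.
    by apply: jodd; rewrite -{1}exj.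
  exact: ext.
- rewrite eyj; apply: (commutes_through_square rhol rhor) => //; last exact: ext.
  by apply: jodd; rewrite -{1}eyj.
- by apply: (commutes_through rhol rhor) => //; exact: ext.
Qed.

Lemma commutes_model v x y : cm x y v.
Proof.
elim/malg_ind: v => [|a u v hu hv|s].
- by rewrite /commutes !(rho_r0 rhor) scaler0 addr0.
- apply: (@commutes_span _ _ _ _ rhor _ _ _ _ (fun w => cm x y w)) => //.
  by apply: lspanP; exact: lspan_gen.
have [ns|nn] := boolP (normal s); first exact: commutes_word.
have r0 u : rho u << s >> = 0.
  rewrite /model_action mlinE big1 // => b _.
  by rewrite mlinU /letter_act (negbTE nn) scaler0.
by rewrite /commutes !r0 !(rho_r0 rhor) scaler0 addr0.
Qed.

Theorem model_bracket p q (u u' : g) v : u \in homog p -> u' \in homog q ->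
  rho (bracket u u') v = rho u (rho u' v) - (-1) ^+ (p && q) *: rho u' (rho u v).
Proof.
move=> hu hu'; rewrite (commutes_homog rhol rhor (commutes_model v) hu hu') addrK.
by [].
Qed.

End ModelCommutation.

(** * Maps out of an induced module *)

Section Representation.
Variables (K : numFieldType) (g : lieSuperalgebra K) (V : lmodType K).
Variable rho : g -> V -> V.
Hypothesis rho_linearl : forall v, linear (rho^~ v).
Hypothesis rho_linearr : forall u, linear (rho u).
Hypothesis rep_bracket : forall p q x y v, x \in homog p -> y \in homog q ->
  rho (bracket x y) v = rho x (rho y v) - (-1) ^+ (p && q) *: rho y (rho x v).

(** Gradings are not needed to evaluate U(g) on a space, so V carries none: a map
    into an ungraded space suffices to show that vectors are nonzero. *)
Fixpoint rep (t : uterm g) (v : V) : V :=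
  match t with
  | UScal a => a *: v
  | UGen x => rho x v
  | UAdd s t => rep s v + rep t v
  | UMul s t => rep s (rep t v)
  end.

Lemma rep_linear t : linear (rep t).
Proof.
elim: t => [b|x|s hs t ht|s hs t ht] a u v /=.
- by rewrite scalerDr !scalerA mulrC.
- exact: rho_linearr.
- by rewrite hs ht scalerDr addrACA.
- by rewrite ht hs.
Qed.
HB.instance Definition _ t := GRing.isLinear.Build K V V *:%R (rep t) (rep_linear t).

Lemma rep_rel s t : urel s t -> rep s =1 rep t.
Proof.
elim=> {s t} //=.
- by move=> s t _ h v; rewrite h.
- by move=> s t r _ st _ tr v; rewrite st.
- by move=> s s' t t' _ hs _ ht v; rewrite hs ht.
- by move=> s s' t t' _ hs _ ht v; rewrite hs ht.
- by move=> s t r v; rewrite addrA.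
- by move=> s t v; rewrite addrC.
- by move=> s v; rewrite scale0r add0r.
- by move=> s v; rewrite scaleN1r addNr scale0r.
- by move=> s v; rewrite scale1r.
- by move=> s v; rewrite scale1r.
- by move=> s t r v; rewrite linearD.
- by move=> a b v; rewrite scalerDl.
- by move=> a b v; rewrite scalerA.
- by move=> a s v; rewrite linearZ.
- by move=> a x y v; exact: rho_linearl.
- by move=> p q x y hx hy v; rewrite (rep_bracket _ hx hy) scaleNr.
Qed.

Definition urep (u : uenv g) : V -> V := ulift rep u.

Lemma urepE t : urep (upi t) = rep t.
Proof. by apply: uliftE => s r sr; apply/funext/rep_rel. Qed.

Lemma urep_linear u : linear (urep u).
Proof. exact: rep_linear. Qed.
HB.instance Definition _ u :=
  GRing.isLinear.Build K V V *:%R (urep u) (urep_linear u).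

Lemma urep_gen x v : urep (ugen x) v = rho x v. Proof. by rewrite urepE. Qed.
Lemma urep_scal a v : urep (uscal g a) v = a *: v. Proof. by rewrite urepE. Qed.
Lemma urepD u u' v : urep (u + u') v = urep u v + urep u' v.
Proof. by elim/uenvP: u => s; elim/uenvP: u' => t; rewrite -upiD !urepE. Qed.
Lemma urepM u u' v : urep (u * u') v = urep u (urep u' v).
Proof. by elim/uenvP: u => s; elim/uenvP: u' => t; rewrite -upiM !urepE. Qed.

Section Frobenius.
Variables (k : lieSuperalgebra K) (phi : lieHom k g) (chi : lieHom k (lineLie K)).
Variable v0 : V.
Hypothesis v0_char : forall y, rho (phi y) v0 = (chi y : K) *: v0.

Local Notation W := (indModule phi (lineModule chi)).
Local Notation w0 := (ipure phi 1 (1 : lineModule chi) : W).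

Lemma urep_umap (t : uterm k) (m : lineModule chi) :
  (m : K) *: urep (umap_term phi t) v0 = (uact_term t m : K) *: v0.
Proof.
elim: t m => [a|y|s hs t ht|s hs t ht] m /=.
- by rewrite urep_scal scalerA mulrC.
- by rewrite urep_gen v0_char scalerA mulrC.
- by rewrite urepD scalerDr hs ht -scalerDl.
- by rewrite urepM -(linearZZ (urep (umap_term phi s))) ht linearZZ hs.
Qed.

(** U(g) (x) K v0 maps to V by u (x) m |-> m (u v0), which is balanced because v0
    spans the one-dimensional module of chi. *)
Theorem frobenius_reciprocity : exists Phi : W -> V,
  [/\ linear Phi, forall x w, Phi (action x w) = rho x (Phi w) & Phi w0 = v0].
Proof.
pose f (u : uenv g) (m : lineModule chi) : V := (m : K) *: urep u v0.
have fDl u u' m : f (u + u') m = f u m + f u' m.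
  by rewrite /f urepD scalerDr.
have fDr u m n : f u (m + n) = f u m + f u n by rewrite /f -scalerDl.
have fbal u s m : f (u * umap phi s) m = f u (uact s m).
  elim/uenvP: s => t; rewrite /f urepM -(linearZZ (urep u)) uactE umapE.
  by rewrite urep_umap linearZZ.
pose Phi : W -> V := ilift (ilin_term f).
have PD w w' : Phi (w + w') = Phi w + Phi w' by exact: ilinD.
have PN w : Phi (- w) = - Phi w by exact: ilinN.
have P0 : Phi 0 = 0 by exact: ilin0.
have Pp u m : Phi (ipure phi u m) = f u m by exact: ilin_pure.
have Pact u w : Phi (iact u w) = urep u (Phi w).
  elim/ind_ind: w => [|w hw|w w' hw hw'|v m].
  - by rewrite iact0r P0 linear0.
  - by rewrite iactNr !PN hw linearN.
  - by rewrite iactDr !PD hw hw' linearD.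
  - by rewrite iact_pure !Pp /f urepM linearZZ.
exists Phi; split.
- by move=> a w w'; rewrite PD iscaleE Pact urep_scal.
- by move=> x w; rewrite -urep_gen -Pact.
- by rewrite Pp /f scale1r -[1]upi1 urepE /= scale1r.
Qed.

End Frobenius.
End Representation.

Section InducedGenerator.
Variables (K : numFieldType) (k g : lieSuperalgebra K) (phi : lieHom k g).
Variable chi : lieHom k (lineLie K).

Local Notation W := (indModule phi (lineModule chi)).

Definition cyclic_vector : W := ipure phi 1 (1 : lineModule chi).
Local Notation w0 := cyclic_vector.

Lemma cyclic_vector_even : w0 \in homog false.
Proof.
rewrite inE; apply/eqP.
have u1 p : ucomp p (1 : uenv g) = if p then 0 else 1 by exact: ucomp_scal.
have P0 m : ipure phi 0 m = 0 :> ind phi (lineModule chi).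
  by rewrite -(scale0r 0) ipureZl scale0r.
by rewrite [LHS]icompE /icomp_pure !u1 P0 addr0.
Qed.

Lemma cyclic_vector_char y : action (phi y) w0 = (chi y : K) *: w0.
Proof.
have -> : action (phi y) w0 = ipure phi (1 * umap phi (ugen y)) (1 : lineModule chi).
  by rewrite [LHS]iact_pure umap_gen mulr1 mul1r.
by rewrite ipure_balanced uact_gen -ipureZr.
Qed.

Lemma cyclic_vector_ind (P : W -> Prop) : P w0 ->
  (forall a v w, P v -> P w -> P (a *: v + w)) ->
  (forall x w, P w -> P (action x w)) -> forall w, P w.
Proof.
move=> P1 PL PA.
have P0 : P 0 by rewrite -[0](addNr w0) -scaleN1r; exact: PL.
have PZ a w : P w -> P (a *: w) by move=> hw; rewrite -[_ *: _]addr0; exact: PL.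
have PD v w : P v -> P w -> P (v + w) by move=> hv; rewrite -[v]scale1r; exact: PL.
have PU t w : P w -> P (iact (upi t) w).
  elim: t w => [a|x|s hs t ht|s hs t ht] w hw; [exact: PZ|exact: PA| |].
    by rewrite upiD iactDl; apply: PD; auto.
  by rewrite upiM iactM; auto.
elim/ind_ind => [//|w hw|w w' hw hw'|u m].
- by rewrite -scaleN1r; exact: PZ.
- exact: PD.
have -> : m = (m : K) *: (1 : lineModule chi) by rewrite /GRing.scale /= mulr1.
rewrite ipureZr; apply: PZ.
by rewrite -[u]upi_repr -[upi _]mulr1 -iact_pure; exact: PU.
Qed.

End InducedGenerator.

(** * The character and its models *)

Section WhittakerCharacter.
Variables (K : numFieldType) (h : bool) (psi : lieHom (pLie K h) (lineLie K)).

Local Notation g := (svir K h).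
Local Notation e b := (<< b >> : svir_space K).
Local Notation br x y := (svir_bracket h (e x) (e y)).

(** Extension by zero, which allows psi to be evaluated on the letters without
    carrying proofs of membership. *)
Definition psi_ext (u : svir_space K) : K :=
  if insub u is Some x then psi (x : sub_lie (p_sub K h)) else 0.

Lemma psi_extE (x : pLie K h) : psi_ext (val x) = psi x.
Proof. by rewrite /psi_ext valK. Qed.

Definition psib (b : basis) : K := psi_ext (e b).

Lemma psib_out b : ~~ p_basis h b -> psib b = 0.
Proof.
move=> nb; rewrite /psib /psi_ext insubF //; apply/negbTE.
apply/negP => /p_memP /(_ b nb) /eqP.
by rewrite mcoeffUU oner_eq0.
Qed.

Lemma psi_ext_mlin (u : svir_space K) : u \in @p_mem K h ->
  psi_ext u = mlin (psib : basis -> K^o) u.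
Proof.
move=> hu; suff [] : u \in @p_mem K h /\ psi_ext u = mlin (psib : basis -> K^o) u by [].
move: u hu; apply: p_mem_ind => [|a x y [hx ex] [hy ey]|b hb].
- split; first exact: (p_mem_submod K h).1.
  rewrite mlin0 -[0 in LHS](@linear0 _ _ _ _ (val : pLie K h -> g)) psi_extE.
  exact: (linear0 psi).
- split; first exact: (p_mem_submod K h).2.
  pose x' : pLie K h := Sub x hx; pose y' : pLie K h := Sub y hy.
  rewrite mlinD mlinZ -ex -ey -[x]/(val x') -[y]/(val y').
  have -> : a *: val x' + val y' = val (a *: x' + y') by [].
  by rewrite !psi_extE linearP.
- by split; [exact: p_mem_basis | rewrite mlinU].
Qed.

Lemma psib_pL n (n1 : 1 <= n) : psib (BL n) = psi (pL K h n1).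
Proof. by rewrite -psi_extE. Qed.

Lemma psib_bracket a b : p_basis h a -> p_basis h b ->
  mlin (psib : basis -> K^o) (br a b) = 0.
Proof.
move=> ha hb; pose x : pLie K h := Sub (e a) (p_mem_basis K ha).
pose y : pLie K h := Sub (e b) (p_mem_basis K hb).
have -> : br a b = val (bracket x y) by [].
rewrite -psi_ext_mlin; last exact: (valP (bracket x y)).
by rewrite psi_extE lie_fun_bracket.
Qed.

Lemma psib_odd b : basis_parity b -> psib b = 0.
Proof.
move=> ob; have [hb|/psib_out //] := boolP (p_basis h b).
pose x : pLie K h := Sub (e b) (p_mem_basis K hb).
rewrite /psib -[e b]/(val x) psi_extE.
have hx : x \in homog true.
  by rewrite sub_homog; have := basis_homog K b; rewrite ob.
by move: hx; rewrite inE => /eqP <-; rewrite lie_fun_component.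
Qed.

(** [L_1, L_(n-1)] = (2 - n) L_n, and psi kills brackets. *)
Lemma psib_high n : 3 <= n -> psib (BL n) = 0.
Proof.
move=> n3; have h1 : p_basis h (BL 1) by [].
have hn : p_basis h (BL (n - 1)) by rewrite /=; lia.
have := psib_bracket h1 hn; rewrite svir_bracketU /=.
have -> : 1 + (n - 1) = n by lia.
have -> : (n == 0) = false by lia.
rewrite scale0r addr0 mlinZ mlinU => /eqP.
by rewrite /GRing.scale /= mulf_eq0 intr_eq0 => /orP[/eqP|/eqP //]; lia.
Qed.

Lemma psi_nonzero : (exists x, psi x != 0) -> psib (BL 1) != 0 \/ psib (BL 2) != 0.
Proof.
case=> x; have [/eqP p1|] := boolP (psib (BL 1) == 0); last by left.
have [/eqP p2|] := boolP (psib (BL 2) == 0); last by right.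
rewrite -psi_extE psi_ext_mlin; last exact: (valP x).
rewrite mlinE big1 ?eqxx // => b _.
suff -> : psib b = 0 by rewrite scaler0.
case: b => [m|k|]; last exact: psib_out.
- have [hm|/psib_out //] := boolP (p_basis h (BL m)).
  have [m3|] := boolP (3 <= m); first exact: psib_high.
  rewrite /= in hm => m3; have : m = 1 \/ m = 2 by lia.
  by case=> ->.
- exact: psib_odd.
Qed.

Variable c : K.

Definition wchar (b : basis) : K := if b is BC then c else psib b.

Lemma wchar_odd b : basis_parity b -> wchar b = 0.
Proof. by case: b => // k; exact: psib_odd. Qed.

Lemma p_mem_span (S : basis -> Prop) : (forall b, p_basis h b -> S b) ->
  forall u, u \in @p_mem K h ->
  supported S u.
Proof.
move=> hS; apply: p_mem_ind => [|a x y hx hy|b /hS sb].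
- exact: lspan0.
- exact: lspanP.
- by apply: lspan_gen; exists b.
Qed.

Lemma mlin_wchar (u : svir_space K) : u \in @p_mem K h ->
  mlin (wchar : basis -> K^o) u = psi_ext u.
Proof.
move=> hu; rewrite psi_ext_mlin //.
apply: (@mlin_eq_span _ _ _ (fun b => p_basis h b)); last exact: p_mem_span hu.
by case.
Qed.

Local Notation W := (Wmodule psi c).
Definition wvec : W := cyclic_vector (pc_inclusion K h) (pc_character psi c).

Section Model.
Variable N : pred basis.
Hypothesis N_p : forall b, p_basis h b -> ~~ N b.
Hypothesis N_C : ~~ N BC.
Hypothesis wchar_bracket : forall x y, ~~ N x -> ~~ N y -> in_kernel N wchar (br x y).

Local Notation rho := (@model_action K h N wchar).

Lemma model_map : exists Phi : W -> {malg K[seq basis]},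
  [/\ linear Phi, forall x w, Phi (action x w) = rho x (Phi w) &
      Phi wvec = << [::] >>].
Proof.
apply: (@frobenius_reciprocity _ _ _ rho).
- exact: model_linearl.
- exact: model_linearr.
- by move=> p q x y v; exact: (model_bracket wchar_odd wchar_bracket).
move=> [x a].
change (rho (val x + (a : K) *: svirC K h) << [::] >> =
  (psi x + (a : K) * c : K) *: << [::] >>).
have sx : supported (fun b => ~~ N b) (val x + (a : K) *: svirC K h).
  apply: lspanD; first by apply: p_mem_span (valP x).
  by apply/lspanZ/lspan_gen; exists BC.
rewrite (model_vacuum _ wchar sx) mlinD mlinZ mlinU mlin_wchar; last exact: (valP x).
by rewrite psi_extE.
Qed.

End Model.

Lemma in_kernel_C N b : in_kernel N wchar (br BC b) /\ in_kernel N wchar (br b BC).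
Proof.
have k0 : in_kernel N wchar 0 by split; [exact: lspan0 | rewrite mlin0].
by rewrite svir_bracketCl svir_bracketCr.
Qed.

Lemma in_kernel_p N x y : (forall b, p_basis h b -> ~~ N b) ->
  p_basis h x -> p_basis h y -> in_kernel N wchar (br x y).
Proof.
move=> pN px py.
have pxy : br x y \in @p_mem K h.
  by apply: p_mem_bracket; exact: p_mem_basis.
split; first exact: (p_mem_span pN pxy).
by rewrite mlin_wchar // psi_ext_mlin // psib_bracket.
Qed.

Lemma creation_bracket x y : ~~ creation h x -> ~~ creation h y ->
  in_kernel (creation h) wchar (br x y).
Proof.
move=> /creation_spec[px|->]; last by move=> _; exact: (in_kernel_C _ y).1.
move=> /creation_spec[py|->]; last exact: (in_kernel_C _ x).2.
by apply: in_kernel_p => // -[m|k|] //= ?; lia.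
Qed.

Lemma wvec_map : exists Phi : W -> {malg K[seq basis]},
  [/\ linear Phi, forall x w, Phi (action x w) = @model_action K h (creation h) wchar x (Phi w) &
      Phi wvec = << [::] >>].
Proof. by apply: model_map creation_bracket => // -[m|k|] //= ?; lia. Qed.

Lemma word_neq0 (s : seq basis) : (<< s >> : {malg K[seq basis]}) != 0.
Proof. by rewrite monalgU_eq0 oner_eq0. Qed.

(** The only place where simplicity uses that the straightening is consistent. *)
Lemma wvec_neq0 : wvec != 0.
Proof.
have [Phi [Pl _ Pw]] := wvec_map; apply: contraTneq (word_neq0 [::]) => w0.
have P0 := linear_at0 Pl.
by rewrite -Pw w0 P0 eqxx.
Qed.

(** ** The case epsilon = 0 and psi(L_2) = 0 *)

Section Nonsimple.
Hypothesis h0 : h = false.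
Hypothesis psi2 : psib (BL 2) = 0.

Definition creation1 (b : basis) := creation h b && (b != BG 1).

Lemma creation1_spec b : ~~ creation1 b -> [\/ p_basis h b, b = BC | b = BG 1].
Proof.
rewrite negb_and negbK => /orP[/creation_spec[]|/eqP]; [exact: Or31|exact: Or32|exact: Or33].
Qed.

(** psi extends by zero to G_1: the brackets of G_1 with p lie in the span of the
    G_k with k >= 2 and of the L_n with n >= 3, and [G_1, G_1] = 2 L_2. *)
Lemma creation1_bracket x y : ~~ creation1 x -> ~~ creation1 y ->
  in_kernel creation1 wchar (br x y).
Proof.
have pS b : p_basis h b -> ~~ creation1 b.
  by rewrite /creation1; case: b => [m|k|] //= ?; rewrite negb_and; apply/orP; left; lia.
have kU a b : ~~ creation1 b -> wchar b = 0 -> in_kernel creation1 wchar (a *: e b).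
  move=> nb wb; split; first by apply/lspanZ/lspan_gen; exists b.
  by rewrite mlinZ mlinU wb scaler0.
have kG z : p_basis h z -> in_kernel creation1 wchar (br z (BG 1)).
  move=> pz; rewrite svir_bracketU; case: z pz => [m|k|] //= pz.
    by apply: kU; [apply: pS => /=; lia | exact: psib_odd].
  have -> : (k + 1 + h%:Z == 0) = false by lia.
  rewrite scale0r addr0; apply: kU; first by apply: pS => /=; lia.
  by apply: psib_high; lia.
move=> /creation1_spec[px|->|->]; last 2 first.
- by move=> _; exact: (in_kernel_C _ y).1.
- move=> /creation1_spec[py|->|->]; last 2 first.
  + exact: (in_kernel_C _ _).2.
  + (* G_1^2 = L_2, on which psi vanishes *)
    by rewrite svir_bracketU /= h0 scale0r addr0; apply: kU.
  have hy := basis_homog K y; have hG := basis_homog K (BG 1).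
  rewrite (svir_bracket_skew h hG hy); have [s1 s2] := kG y py.
  split; first by apply/lspanN/lspanZ.
  by rewrite -scaleN1r !mlinZ s2 !scaler0.
move=> /creation1_spec[py|->|->]; last exact: kG.
  exact: in_kernel_p.
exact: (in_kernel_C _ x).2.
Qed.

Lemma wvec1_map : exists Phi : W -> {malg K[seq basis]},
  [/\ linear Phi, forall x w, Phi (action x w) = @model_action K h creation1 wchar x (Phi w) &
      Phi wvec = << [::] >>].
Proof.
apply: model_map creation1_bracket => //.
by move=> b pb; apply/negP => /andP[nb _]; move: b pb nb => [m|k|] //= ? ?; lia.
Qed.

Lemma G1_wvec_neq0 : action (svirG K h 1) wvec != 0.
Proof.
have [Phi [Pl Pa Pw]] := wvec_map; apply: contraTneq (word_neq0 [:: BG 1]) => w0.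
have P0 := linear_at0 Pl.
have n1 : normal h (creation h) [:: BG 1] by rewrite normal_cons /= h0.
have := Pa (svirG K h 1) wvec; rewrite w0 P0 Pw act_front // => <-.
by rewrite eqxx.
Qed.

(** The model without G_1 is not graded, so its kernel is replaced by the set of
    vectors both of whose components are killed; it contains G_1 w but not w. *)
Theorem not_simple : ~ simple_module W.
Proof.
have [Phi [Pl Pa Pw]] := wvec1_map.
have P0 := linear_at0 Pl.
pose N : {pred W} := [pred v | `[< forall p, Phi (component p v) = 0 >]].
have NP v : reflect (forall p, Phi (component p v) = 0) (v \in N) by exact: asboolP.
have gN : graded_submodule N.
  split.
  - split; first by apply/NP => p; rewrite linear0 P0.
    move=> a u v /NP hu /NP hv; apply/NP => p.
    by rewrite linearP Pl hu hv scaler0 addr0.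
  - move=> p v /NP hv; apply/NP => q; rewrite componentK.
    by case: ifP.
  - move=> x v /NP hv; apply/NP => p; rewrite component_action.
    have D u u' : Phi (u + u') = Phi u + Phi u'.
      by have := Pl 1 u u'; rewrite !scale1r.
    rewrite D !Pa !hv !(rho_r0 (@model_linearr K h creation1 wchar)).
    by rewrite addr0.
case=> _ /(_ N gN) [/(_ (action (svirG K h 1) wvec)) H|/(_ wvec) /NP /(_ false)].
  have /eqP := G1_wvec_neq0; apply; apply: H; apply/NP => p.
  have hG : (svirG K h 1 : g) \in homog true by exact: (basis_homog K (BG 1)).
  have hw : wvec \in homog false by exact: cyclic_vector_even.
  have := action_homog hG hw => /(homogE p) ->.
  case: ifP => // _; rewrite Pa Pw act_nil; last by rewrite /creation1 eqxx andbF.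
  by rewrite [wchar _]psib_odd // scale0r.
have hw : wvec \in homog false by exact: cyclic_vector_even.
rewrite (homogE false hw) Pw => /eqP.
by apply/negP; exact: word_neq0.
Qed.

End Nonsimple.

End WhittakerCharacter.

(** * The degree filtration *)

Section LetterArithmetic.
Variables (K : numFieldType) (h : bool).

Local Notation e b := (<< b >> : svir_space K).
Local Notation br x y := (svir_bracket h (e x) (e y)).

(** Twice the index, which makes half-integers integral. *)
Definition index2 (b : basis) : int :=
  match b with BL m => 2 * m | BG k => 2 * k + h%:Z | BC => 0 end.

Definition basis_sum (x y : basis) : basis :=
  match x, y with
  | BL m, BL n => BL (m + n)
  | BL m, BG k | BG k, BL m => BG (m + k)
  | BG k, BG l => BL (k + l + h%:Z)
  | BC, _ | _, BC => BC
  end.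

Lemma index2_sum x y : x != BC -> y != BC -> index2 (basis_sum x y) = index2 x + index2 y.
Proof. by case: x y => [m|k|] [n|l|] //= _ _; lia. Qed.

(** Brackets are homogeneous for the index; the central term needs total index 0. *)
Lemma bracket_basisE x y : exists a b, br x y = a *: e (basis_sum x y) + b *: e BC /\
  (b = 0 \/ index2 x + index2 y = 0).
Proof.
rewrite svir_bracketU; case: x y => [m|k|] [n|l|] /=;
  try by exists 0, 0; rewrite !scale0r addr0; split; [|left].
- eexists _, _; split; first reflexivity.
  by case: eqP => [mn|_]; [right; lia | left].
- by eexists _, 0; rewrite scale0r addr0; split; [reflexivity|left].
- eexists (- _), 0; rewrite scale0r addr0 scaleNr; split; [reflexivity|by left].
- eexists _, _; split; first reflexivity.
  by case: eqP => [mn|_]; [right; lia | left].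
Qed.

End LetterArithmetic.

Section WhittakerModule.
Variables (K : numFieldType) (h : bool) (M : lieModule (svir K h)) (w : M).
Variable chi : basis -> K.
Variable d : int.

Local Notation g := (svir K h).
Local Notation e b := (<< b >> : g).
Local Notation br x y := (svir_bracket h (<< x >> : svir_space K) << y >>).
Local Notation act b := (@action K g M (e b)).
Local Notation abr x y := (@action K g M (br x y)).
Local Notation sgn x y := ((-1) ^+ (basis_parity x && basis_parity y) : K).
Local Notation creation := (creation h).
Local Notation normal := (normal h creation).
Local Notation index2 := (index2 h).
Local Notation basis_sum := (basis_sum h).
Local Notation rank := (rank h).

(* d is the top index on which the character does not vanish; the second
   condition excludes d = 1, h = 0, where G_1 would get degree 0 *)
Hypothesis d_range : 1 <= d <= 2.
Hypothesis d_h : 2 <= d + h%:Z.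
Hypothesis chi_odd : forall b, basis_parity b -> chi b = 0.
Hypothesis chi_high : forall n : int, d < n -> chi (BL n) = 0.
Hypothesis w_char : forall b, ~~ creation b -> act b w = chi b *: w.

Lemma action_swap x y v : act x (act y v) =
  abr x y v + sgn x y *: act y (act x v).
Proof.
have := action_bracket v (basis_homog K x : (e x) \in homog _)
  (basis_homog K y : (e y) \in homog _).
by move=> ->; rewrite subrK.
Qed.

(** The degree is doubled, like the index. A creation letter has positive degree,
    L_d has degree 0, and the bracket of two letters loses 2 d. *)
Definition deg (b : basis) : int := 2 * d - index2 b.
Definition wdeg (s : seq basis) : int := foldr (fun b n => deg b + n) 0 s.
Definition word (s : seq basis) : M := foldr (fun b v => act b v) w s.

Lemma wdeg_cons b s : wdeg (b :: s) = deg b + wdeg s. Proof. by []. Qed.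
Lemma word_cons b s : word (b :: s) = act b (word s). Proof. by []. Qed.

Lemma wdeg_perm s t : perm_eq s t -> wdeg s = wdeg t.
Proof.
have E u : wdeg u = \sum_(b <- u) deg b.
  by elim: u => [|b u IH]; rewrite ?big_nil // big_cons -IH.
by rewrite !E; exact: perm_big.
Qed.

Lemma deg_gt0 b : creation b -> 0 < deg b.
Proof. by rewrite /deg; case: b => [m|k|] //= nb; lia. Qed.

Lemma wdeg_ge0 s : all creation s -> 0 <= wdeg s.
Proof. by elim: s => //= b s IH /andP[/deg_gt0 nb /IH ns]; lia. Qed.

(** Spanned by all words in creation letters, not only by the normal ones, so that
    prepending a creation letter is compatible with the filtration by definition. *)
Definition filt (D : int) : M -> Prop :=
  lspan (fun v => exists2 s, all creation s && (wdeg s <= D) & v = word s).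

Lemma filt_word D s : all creation s -> wdeg s <= D -> filt D (word s).
Proof. by move=> ns sD; apply: lspan_gen; exists s; rewrite ?ns. Qed.

Lemma filt_mono D E v : D <= E -> filt D v -> filt E v.
Proof.
move=> DE; apply: lspan_mono => _ [s /andP[ns sD] ->].
by exists s; rewrite ?ns ?(le_trans sD).
Qed.

Lemma filt_lin (f : {linear M -> M}) D E : 
  (forall s, all creation s -> wdeg s <= D -> filt E (f (word s))) ->
  forall v, filt D v -> filt E (f v).
Proof.
by move=> hf v; apply: lspan_image => _ [s /andP[ns sD] ->]; exact: hf.
Qed.

Lemma filt_creation D b v : creation b -> filt D v -> filt (D + deg b) (act b v).
Proof.
move=> nb; apply: (@filt_lin (act b)) => s ns sD.
by apply: (@filt_word _ (b :: s)); rewrite ?wdeg_cons /= ?nb //; lia.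
Qed.

Lemma C_word s : all creation s -> act BC (word s) = chi BC *: word s.
Proof.
elim: s => [|b s IH] ns; first exact: w_char.
case/andP: ns => nb ns.
rewrite word_cons action_swap (svir_bracketCl (K:=K) h) andFb expr0 scale1r IH //.
rewrite (linearZZ (act b)).
by rewrite -[X in X + _]/(actionl _ 0) linear0 add0r.
Qed.

Lemma filt_C D v : filt D v -> filt D (act BC v).
Proof.
apply: (@filt_lin (act BC)) => s ns sD.
change (filt D (act BC (word s))).
by rewrite C_word //; apply/lspanZ/filt_word.
Qed.

(** The operator x - chi(x), which annihilates w for x in p_epsilon. *)
Definition defect (b : basis) (v : M) : M := act b v - chi b *: v.

Fact defect_linear b : linear (defect b).
Proof.
move=> a u v; rewrite /defect linearP /= scalerDr opprD addrACA scalerBr !scalerA.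
by rewrite [a * _]mulrC.
Qed.
HB.instance Definition _ b := GRing.isLinear.Build K M M *:%R (defect b) (defect_linear b).

Lemma defect_swap b j v :
  defect b (act j v) = abr b j v + sgn b j *: act j (defect b v).
Proof.
rewrite /defect action_swap -addrA; congr (_ + _).
have chi_sgn : sgn b j * chi b = chi b.
  by have [/chi_odd->|_] := boolP (basis_parity b); rewrite ?mulr0 ?mul1r.
rewrite (linearB (act j)) (linearZZ (act j)) scalerBr.
by rewrite [sgn b j *: (chi b *: _)]scalerA chi_sgn.
Qed.

Lemma chi_deg b : chi b = 0 \/ 0 <= deg b.
Proof.
case: b => [m|k|]; [|by left; exact: chi_odd|by right; rewrite /deg /=; lia].
have [/chi_high ->|md] := ltP d m; first by left.
by right; rewrite /deg /=; lia.
Qed.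

Lemma filt_word_act s : all creation s ->
  (forall b, p_basis h b -> filt (wdeg s - index2 b) (defect b (word s))) ->
  forall b, filt (wdeg s + deg b) (act b (word s)).
Proof.
move=> ns AB b; have [nb|/creation_spec[pb|->]] := boolP (creation b).
- by apply: filt_creation => //; exact: filt_word.
- rewrite -[act b _](subrK (chi b *: word s)); apply: lspanD.
    by apply: filt_mono (AB b pb); rewrite /deg; lia.
  have [->|db] := chi_deg b; first by rewrite scale0r; exact: lspan0.
  by apply/lspanZ/filt_word => //; lia.
- by rewrite C_word //; apply/lspanZ/filt_word => //; rewrite /deg /=; lia.
Qed.

Lemma p_basis_neqC b : p_basis h b -> b != BC.
Proof. by case: b. Qed.

Lemma creation_neqC b : creation b -> b != BC.
Proof. by case: b. Qed.

Lemma abr_basisE x y : exists a b,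
  (forall v, abr x y v = a *: act (basis_sum x y) v + b *: act BC v) /\
  (b = 0 \/ index2 x + index2 y = 0).
Proof.
have [a [b [E hb]]] := bracket_basisE K h x y; exists a, b; split=> // v.
rewrite E; move: (e (basis_sum x y)) (e BC) => u u'.
by rewrite actionDl !actionZl.
Qed.

(** The bound on filt_act is assumed for the word s only, so that this serves in
    the induction that proves it. *)
Lemma filt_abr_word x y s D : x != BC -> y != BC -> all creation s ->
  (forall b, filt (wdeg s + deg b) (act b (word s))) ->
  wdeg s + 2 * d - index2 x - index2 y <= D -> filt D (abr x y (word s)).
Proof.
move=> xC yC ns A DD; have [a [b [-> hb]]] := abr_basisE x y.
have fC : filt D (b *: act BC (word s)).
  case: hb => [->|hb]; first by rewrite scale0r; exact: lspan0.
  by apply/lspanZ/filt_C/filt_word => //; lia.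
apply: lspanD fC; apply: lspanZ.
by apply: filt_mono (A _); rewrite /deg index2_sum //; lia.
Qed.

(** Induction on the word: moving x past j produces [x, j], of doubled index
    i(x) + i(j), whose degree 2 d - i(x) - i(j) is that of j minus i(x). *)
Lemma filt_defect_word s : all creation s -> forall b, p_basis h b ->
  filt (wdeg s - index2 b) (defect b (word s)).
Proof.
elim: s => [|j s IH] ns b pb.
  have nb : ~~ creation b by case: b pb => [m|k|] //= ?; lia.
  by rewrite /defect w_char // subrr; exact: lspan0.
case/andP: ns => nj ns; have {}IH := IH ns.
have A := filt_word_act ns IH.
rewrite word_cons defect_swap; apply: lspanD.
  apply: filt_abr_word => //; [exact: p_basis_neqC|exact: creation_neqC|].
  by rewrite wdeg_cons /deg; lia.
apply: lspanZ; apply: filt_mono (filt_creation nj (IH b pb)).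
by rewrite wdeg_cons; lia.
Qed.

Lemma filt_act b D v : filt D v -> filt (D + deg b) (act b v).
Proof.
apply: (@filt_lin (act b)) => s ns sD.
apply: filt_mono (filt_word_act ns (filt_defect_word ns) b); lia.
Qed.

Lemma filt_defect b D v : p_basis h b -> filt D v -> filt (D - index2 b) (defect b v).
Proof.
move=> pb; apply: (@filt_lin (defect b)) => s ns sD.
apply: filt_mono (filt_defect_word ns pb); lia.
Qed.

Lemma filt_abr x y s D : x != BC -> y != BC -> all creation s ->
  wdeg s + 2 * d - index2 x - index2 y <= D -> filt D (abr x y (word s)).
Proof.
move=> xC yC ns; apply: filt_abr_word => //.
exact: filt_word_act ns (filt_defect_word ns).
Qed.

Lemma square_abr j v : basis_parity j -> act j (act j v) = 2^-1 *: abr j j v.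
Proof.
move=> oj; apply/double_half.
by rewrite {1}action_swap oj expr1 scaleN1r.
Qed.

(** Modulo the filtration, letters supercommute: a word is a multiple of a normal
    rearrangement of itself. The case c = 0 is that of a repeated odd letter. *)
Definition sortable D s v := exists c t,
  [/\ perm_eq t s, c = 0 \/ normal t & filt D (v - c *: word t)].

Lemma sortable_cons j s : creation j -> normal s ->
  sortable (wdeg (j :: s) - 1) (j :: s) (word (j :: s)).
Proof.
move=> nj; elim: s => [|i u IH] ns.
  exists 1, [:: j]; rewrite scale1r subrr normal_cons nj.
  by split; [exact: perm_refl | right | exact: lspan0].
have [njs|nn] := boolP (normal (j :: i :: u)).
  exists 1, [:: j, i & u]; rewrite scale1r subrr.
  by split; [exact: perm_refl | right | exact: lspan0].
have nu := normal_behead ns.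
have /andP[ni au] : all creation (i :: u) by case/andP: ns.
have [eji|ji] := eqVneq j i.
  move: nn; rewrite eji => /(normal_repeat ns) oi.
  exists 0, [:: i, i & u]; split; [exact: perm_refl|by left|].
  rewrite scale0r subr0 !word_cons square_abr //; apply/lspanZ/filt_abr => //;
    try exact: creation_neqC.
  by rewrite !wdeg_cons /deg; lia.
have [c [t [pt nt ft]]] := IH nu.
exists (sgn j i * c), (i :: t); split.
- apply: (@perm_trans _ (i :: j :: u)); first by rewrite perm_cons.
  by rewrite -(cat1s i) -(cat1s j) perm_catCA.
- case: nt => [->|nt]; [by rewrite mulr0; left|right].
  exact: normal_front pt nt.
have -> : word [:: j, i & u] - (sgn j i * c) *: word (i :: t) =
    abr j i (word u) + sgn j i *: act i (word (j :: u) - c *: word t).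
  rewrite !word_cons action_swap -addrA -scalerA -scalerBr.
  by rewrite (linearB (act i)) (linearZZ (act i)).
apply: lspanD; first apply: filt_abr => //; try exact: creation_neqC.
  by rewrite !wdeg_cons /deg; lia.
apply: lspanZ; apply: filt_mono (filt_creation ni ft).
by rewrite !wdeg_cons; lia.
Qed.

Lemma sortable_word s : all creation s -> sortable (wdeg s - 1) s (word s).
Proof.
elim: s => [|j s IH] ns.
  exists 1, [::]; rewrite scale1r subrr.
  by split; [exact: perm_refl | right | exact: lspan0].
case/andP: ns => nj /IH [c [t [pt nt ft]]].
have fj : filt (wdeg (j :: s) - 1) (act j (word s - c *: word t)).
  by apply: filt_mono (filt_creation nj ft); rewrite wdeg_cons; lia.
have E v : word (j :: s) - v = act j (word s - c *: word t) + (c *: word (j :: t) - v).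
  by rewrite (linearB (act j)) (linearZZ (act j)) addrA subrK.
case: nt => [c0|nt].
  exists 0, (j :: s); split; [exact: perm_refl|by left|].
  by rewrite scale0r subr0; move: fj; rewrite c0 scale0r subr0.
have [c' [t' [pt' nt' ft']]] := sortable_cons nj nt.
exists (c * c'), t'; split.
- by apply: (perm_trans pt'); rewrite perm_cons.
- by case: nt' => [->|nt']; [left; rewrite mulr0|right].
rewrite E; apply: lspanD => //; rewrite -scalerA -scalerBr; apply: lspanZ.
apply: filt_mono ft'.
by rewrite !wdeg_cons (wdeg_perm pt).
Qed.

Definition homogeneous D (P : {malg K[seq basis]}) :=
  forall s, s \in msupp P -> normal s /\ wdeg s = D.

Definition eval (P : {malg K[seq basis]}) : M := mlin word P.

(** P is the symbol of v in degree D; it is zero when v has lower degree. *)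
Lemma symbol_exists D v : filt D v ->
  exists2 P, homogeneous D P & filt (D - 1) (v - eval P).
Proof.
have h0 : homogeneous D 0 by move=> s; rewrite msupp0.
elim=> [|a u u' _ [P hP fP] _ [P' hP' fP']|_ [s /andP[ns sD] ->]].
- by exists 0 => //; rewrite /eval mlin0 subrr; exact: lspan0.
- exists (a *: P + P').
    move=> s /(fsubsetP (msuppD_le _ _)); rewrite in_fsetU => /orP[|/hP' //].
    by move=> /(fsubsetP (msuppZ_le _ _)) /hP.
  rewrite /eval mlinD mlinZ opprD addrACA -scalerBr.
  exact: lspanP.
have [lt|ge] := ltP (wdeg s) D.
  exists 0 => //; rewrite /eval mlin0 subr0; apply: filt_word => //; lia.
have eD : wdeg s = D by apply: le_anti; rewrite sD.
have [c [t [pt nt ft]]] := sortable_word ns.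
case: nt => [c0|nt].
  exists 0 => //; rewrite /eval mlin0 -eD.
  by move: ft; rewrite c0 scale0r.
exists (c *: << t >>).
  move=> r /(fsubsetP (msuppZ_le _ _)) /(fsubsetP msuppU_le).
  by rewrite in_fset1 => /eqP ->; rewrite (wdeg_perm pt).
by rewrite /eval mlinZ mlinU -eD.
Qed.

(** * Lowering the symbol *)

(** The letter whose index and that of b add up to d. *)
Definition partner (b : basis) : basis :=
  match b with BL m => BL (d - m) | BG k => BG (d - h%:Z - k) | BC => BC end.

Lemma partner_index2 b : creation b -> index2 (partner b) = deg b.
Proof. by rewrite /deg; case: b => [m|k|] //= _; lia. Qed.

Lemma partner_abr b : creation b -> exists2 kap, kap != 0 &
  forall v, abr (partner b) b v = kap *: act (BL d) v.
Proof.
case: b => [m|k|] //= nb.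
- exists ((d - m - m)%:~R); first by rewrite intr_eq0; lia.
  move=> v; rewrite svir_bracketU /= subrK.
  have -> : (d == 0) = false by lia.
  by rewrite scale0r addr0 actionZl.
- exists 2; first by rewrite pnatr_eq0.
  move=> v; rewrite svir_bracketU /= -addrA.
  have -> : d - h%:Z - k + (k + h%:Z) = d by lia.
  have -> : (d == 0) = false by lia.
  by rewrite scale0r addr0 actionZl.
Qed.

(** A smaller letter j has an index not below that of b, so the bracket of the
    partner of b with j has index at least d. It equals d only in the tie between
    L_k and G_k, and then the bracket is odd; in all other cases it is beyond the
    support of the character. *)
Lemma partner_lower b j : creation b -> creation j -> rank j < rank b ->
  [/\ p_basis h (basis_sum (partner b) j), chi (basis_sum (partner b) j) = 0 &
      index2 b <= index2 j].
Proof.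
case: b j => [m|k|] [n|l|] //= nb nj lt.
- by split; [lia | apply: chi_high; lia | lia].
- by split; [lia | exact: chi_odd | lia].
- by split; [lia | exact: chi_odd | lia].
- by split; [lia | apply: chi_high; lia | lia].
Qed.

Lemma count_head b s : normal s -> all (fun j => rank j <= rank b) s ->
  b \in s -> s = b :: behead s.
Proof.
case: s => [//|i u] ns /= /andP[ib _]; rewrite inE => /orP[/eqP-> //|bu].
move: ns; rewrite normal_cons => /and3P[_ /allP/(_ b bu) pib _].
case/orP: pib => [bi|/andP[/eqP-> _] //].
by have := lt_le_trans bi ib; rewrite ltxx.
Qed.

(** On words with largest letter b, the defect of the partner of b acts as a
    multiple of the derivative in b. Since the occurrences of b come first in a
    normal word, differentiation removes the head, multiplied by the number of
    occurrences. *)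
Lemma lead_term b (kap : K) : creation b -> p_basis h (partner b) ->
  (forall v, abr (partner b) b v = kap *: act (BL d) v) ->
  forall s, normal s -> all (fun j => rank j <= rank b) s ->
  filt (wdeg s - deg b - 1) (defect (partner b) (word s) -
     (kap * chi (BL d) * (count_mem b s)%:R) *: word (behead s)).
Proof.
move=> nb px Ek; set lam := kap * _.
elim=> [|j s IH] ns rs.
  rewrite /= mulr0 scale0r subr0 /defect w_char ?subrr; first exact: lspan0.
  by move: (partner b) px => [m|k|] //= ?; lia.
have ns' := normal_behead ns.
have nN : all creation s by case/andP: ns' => ->.
have nj : creation j by case/andP: ns => /= /andP[].
case/andP: rs => rj rs; have {}IH := IH ns' rs.
set z := word s in IH *; set x := partner b in px Ek IH *.
have fj D v : filt (D - deg j) v -> filt D (act j v).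
  by move=> /(filt_creation nj); rewrite subrK.
rewrite word_cons defect_swap wdeg_cons -/z; have [ejb|jb] := eqVneq j b.
  have Lz : filt (wdeg s - 1) (abr x j z - lam *: z).
    rewrite ejb Ek /lam -scalerA -scalerBr; apply: lspanZ.
    have pd : p_basis h (BL d) by rewrite /=; lia.
    by apply: filt_mono (filt_defect pd (filt_word nN (lexx _))); rewrite /=; lia.
  have Jz : filt (wdeg s - 1) (sgn x j *: act j (defect x z) -
       (lam * (count_mem b s)%:R) *: z).
    have [bs|nbs] := boolP (b \in s); last first.
      rewrite (count_memPn nbs) mulr0 scale0r subr0; apply/lspanZ/fj.
      move: IH; rewrite (count_memPn nbs) mulr0 scale0r subr0 ejb.
      by apply: filt_mono; lia.
    have es := count_head ns' rs bs.
    have ej : ~~ basis_parity j.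
      move: ns; rewrite normal_cons => /and3P[_ /allP/(_ b bs) + _].
      by rewrite ejb precedes_refl.
    rewrite (negbTE ej) andbF expr0 scale1r.
    have -> : (lam * (count_mem b s)%:R) *: z =
        (lam * (count_mem b s)%:R) *: act j (word (behead s)).
      by rewrite /z {2}es ejb.
    rewrite -(linearZZ (act j)) -(linearB (act j)); apply: fj.
    by apply: filt_mono IH; rewrite ejb; clear -s; lia.
  have -> : (count_mem b (j :: s))%:R = 1 + (count_mem b s)%:R :> K.
    by rewrite /= ejb eqxx natrD.
  have -> : deg j + wdeg s - deg b - 1 = wdeg s - 1 by rewrite ejb; lia.
  rewrite mulrDr mulr1 scalerDl opprD addrACA.
  exact: lspanD.
have lt : rank j < rank b.
  rewrite lt_neqAle rj andbT; apply: contra jb => /eqP/rank_inj ->.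
  exact: eqxx.
have nbs : b \notin s.
  apply/negP => bs; move: ns; rewrite normal_cons => /and3P[_ /allP/(_ b bs) + _].
  case/orP=> [gt|/andP[/eqP ej _]]; last by rewrite ej eqxx in jb.
  by have := lt_trans lt gt; rewrite ltxx.
have c0 : count_mem b (j :: s) = 0%N.
  by apply/count_memPn; rewrite inE negb_or eq_sym jb.
rewrite c0 mulr0 scale0r subr0.
move: IH; rewrite (count_memPn nbs) mulr0 scale0r subr0 => IH.
apply: lspanD; last by apply/lspanZ/fj; apply: filt_mono IH; clear -s; lia.
have [py cy ij] := partner_lower nb nj lt.
have [a [a' [-> ha']]] := abr_basisE x j.
have xC : x != BC by exact: p_basis_neqC.
have a0 : a' = 0.
  case: ha' => // i0; rewrite /x partner_index2 // in i0.
  by exfalso; clear -d_range ij i0; rewrite /deg in i0; lia.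
rewrite a0 scale0r addr0; apply: lspanZ.
have := filt_defect py (filt_word nN (lexx _)).
rewrite /defect cy scale0r subr0; apply: filt_mono.
rewrite index2_sum //; last exact: creation_neqC.
rewrite partner_index2 //; clear -s d_range; rewrite /deg; lia.
Qed.

Lemma head_all b s : normal s -> rank (head BC s) <= rank b ->
  all (fun j => rank j <= rank b) s.
Proof.
case: s => //= i u; rewrite normal_cons => /and3P[_ iu _] ib; rewrite ib /=.
apply: sub_all iu => j /orP[/ltW ji|/andP[/eqP <- _] //].
exact: le_trans ib.
Qed.

Section Lowering.
Variables (b : basis) (lam : K) (P : {malg K[seq basis]}) (D : int).
Hypothesis lam0 : lam != 0.
Hypothesis homP : homogeneous D P.
Hypothesis maxb : forall s, s \in msupp P -> rank (head BC s) <= rank b.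

(** The derivative in b on normal words whose letters do not exceed b. When b does
    not occur the coefficient is 0, so the tail is irrelevant. *)
Definition strip (s : seq basis) : {malg K[seq basis]} :=
  (lam * (count_mem b s)%:R) *: << behead s >>.

(** Removing the head b is injective on the words that start with b, so no
    cancellation occurs. *)
Lemma mcoeff_strip t :
  (mlin strip P)@_t = lam * (count_mem b (b :: t))%:R * P@_(b :: t).
Proof.
have E s : s \in msupp P ->
    (P@_s *: strip s)@_t = if s == b :: t then P@_s * (lam * (count_mem b s)%:R) else 0.
  move=> sP; have [ns _] := homP sP; rewrite !mcoeffZ mcoeffU.
  have [bs|nbs] := boolP (b \in s); last first.
    rewrite (count_memPn nbs) mulr0 mul0r mulr0.
    by case: eqP => // es; rewrite es mem_head in nbs.
  rewrite (count_head ns (head_all ns (maxb sP)) bs) /= eqseq_cons eqxx /=.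
  by case: (behead s == t); rewrite /= ?mulr1 // !mulr0.
rewrite mlinE raddf_sum big_seq (eq_bigr _ E) -big_seq.
have [bt|nbt] := boolP (b :: t \in msupp P).
  rewrite (bigD1_seq (b :: t)) ?fset_uniq //= eqxx big1 ?addr0; first by rewrite mulrC.
  by move=> s /negbTE ->.
rewrite (mcoeff_outdom nbt) mulr0 big_seq big1 // => s sP.
by case: eqP => // es; rewrite -es sP in nbt.
Qed.

Lemma strip_homogeneous : homogeneous (D - deg b) (mlin strip P).
Proof.
move=> t; rewrite -mcoeff_neq0 mcoeff_strip mulf_eq0 negb_or mcoeff_neq0.
case/andP=> _ /homP [nbt <-]; split; first exact: normal_behead nbt.
by rewrite wdeg_cons addrC addKr.
Qed.

Lemma strip_neq0 : has (fun s => b \in s) (msupp P) -> mlin strip P != 0.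
Proof.
case/hasP=> s sP bs; have [ns _] := homP sP.
have es := count_head ns (head_all ns (maxb sP)) bs.
apply/eqP => /(congr1 (mcoeff (behead s))) /eqP.
rewrite mcoeff0 mcoeff_strip -es mulf_eq0 mcoeff_eq0 sP orbF.
rewrite mulf_eq0 (negbTE lam0) /= pnatr_eq0 => /eqP /count_memPn.
by rewrite bs.
Qed.

End Lowering.

Lemma min_letter j : creation j -> rank (BG (1 - h%:Z)) <= rank j.
Proof. by case: j => [m|k|] //= nj; lia. Qed.

Lemma min_deg j : creation j -> deg (BG (1 - h%:Z)) <= deg j.
Proof. by rewrite /deg; case: j => [m|k|] //= nj; lia. Qed.

Lemma filt_negative D v : D < 0 -> filt D v -> v = 0.
Proof.
move=> D0; elim=> [//|a u u' _ -> _ ->|u [s /andP[/wdeg_ge0 s0 sD] _]].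
  by rewrite scaler0 addr0.
by have := le_lt_trans (le_trans s0 sD) D0; rewrite ltxx.
Qed.

Lemma filt_vacuum D v : D < deg (BG (1 - h%:Z)) -> filt D v -> exists a, v = a *: w.
Proof.
move=> D0; elim=> [|a u u' _ [x ->] _ [y ->]|_ [[|j s] /andP[ns sD] ->]].
- by exists 0; rewrite scale0r.
- by exists (a * x + y); rewrite scalerDl scalerA.
- by exists 1; rewrite scale1r.
case/andP: ns => nj /wdeg_ge0 s0; move: sD; rewrite wdeg_cons => sD.
by have := min_deg nj; clear -D0 s0 sD; lia.
Qed.

Hypothesis chi_d : chi (BL d) != 0.
Hypothesis w_even : w \in homog false.

Section Submodule.
Variable N : {pred M}.
Hypothesis gN : graded_submodule N.

Let ND a u v : u \in N -> v \in N -> a *: u + v \in N.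
Proof. by case: gN => -[_ H] _ _; exact: H. Qed.
Let NZ a u : u \in N -> a *: u \in N.
Proof. by case: gN => -[H0 H] _ _ uN; rewrite -[_ *: _]addr0; exact: H. Qed.
Let Nact b u : u \in N -> act b u \in N.
Proof. by case: gN => _ _; apply. Qed.

Lemma NZ_inv a u : a != 0 -> a *: u \in N -> u \in N.
Proof. by move=> a0 /(NZ a^-1); rewrite scalerA mulVf // scale1r. Qed.

Lemma defect_in b v : v \in N -> defect b v \in N.
Proof. by move=> vN; rewrite /defect addrC -scaleNr; apply: ND => //; exact: Nact. Qed.

(** G_T with T = 1 - epsilon is the smallest letter, so the remainder is a multiple
    of w. If d = 2T, the odd component of v is a G_T w, and G_T^2 = L_d. *)
Lemma last_letter a v D : d + h%:Z = 2 -> a != 0 -> v \in N ->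
  D < deg (BG (1 - h%:Z)) -> filt D (v - a *: word [:: BG (1 - h%:Z)]) -> w \in N.
Proof.
move=> dh a0 vN Dlt fv; set G := BG _ in Dlt fv.
have [x vx] := filt_vacuum Dlt fv.
have hG : (e G : g) \in homog true by exact: (basis_homog K G).
have hGw := action_homog hG w_even.
have cv : component true v = a *: act G w.
  rewrite -[v](subrK (a *: word [:: G])) vx linearD !linearZZ /= (homogE true w_even).
  by rewrite scaler0 add0r (homogE true hGw).
have : component true v \in N by case: gN => _ H _; exact: H.
rewrite cv => /(NZ_inv a0) /(Nact G); rewrite square_abr //.
have i2 : (2^-1 : K) != 0 by rewrite invr_eq0 pnatr_eq0.
move=> /(NZ_inv i2).
have nG : creation G by rewrite /=; lia.
have pG : partner G = G by rewrite /=; congr BG; lia.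
have [kap k0 Ek] := partner_abr nG.
rewrite -{1}pG Ek => /(NZ_inv k0); rewrite w_char; last by rewrite /=; lia.
exact: NZ_inv.
Qed.

(** Only the smallest letter can fail to have its partner in p_epsilon; it is then
    its own partner. *)
Lemma partner_p b : creation b -> p_basis h (partner b) \/
  b = BG (1 - h%:Z) /\ d + h%:Z = 2.
Proof.
case: b => [m|k|] //= nb; first by left; lia.
have [lt|ge] := ltP k (1 - h%:Z); first by left; lia.
have ek : k = 1 - h%:Z by lia.
have [d2|] := eqVneq (d + h%:Z) 2; first by right; rewrite ek.
by move=> /eqP d2; left; lia.
Qed.

Lemma single_support (P : {malg K[seq basis]}) t :
  (forall s, s \in msupp P -> s = t) -> P = P@_t *: << t >>.
Proof.
move=> Pt; apply/malgP => s; rewrite mcoeffZ mcoeffU.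
have [<-|ts] := eqVneq t s; first by rewrite mulr1.
rewrite mulr0; apply: mcoeff_outdom; apply/negP => /Pt st.
by rewrite st eqxx in ts.
Qed.

Lemma support_nonempty (P : {malg K[seq basis]}) : P != 0 -> exists s, s \in msupp P.
Proof.
move=> P0; apply: contrapT => no; move/eqP: P0; apply; apply/malgP => s.
by rewrite mcoeff0; apply: mcoeff_outdom; apply/negP => sP; apply: no; exists s.
Qed.

Lemma descend D P v b kap : homogeneous D P -> filt (D - 1) (v - eval P) ->
  creation b -> p_basis h (partner b) ->
  (forall u, abr (partner b) b u = kap *: act (BL d) u) ->
  (forall s, s \in msupp P -> rank (head BC s) <= rank b) ->
  filt (D - deg b - 1)
    (defect (partner b) v - eval (mlin (strip b (kap * chi (BL d))) P)).
Proof.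
move=> hP fv nb px Ek maxb; set x := partner b in px Ek *; set lam := kap * _.
have defectD u u' : defect x (u + u') = defect x u + defect x u' by exact: linearD.
rewrite -[v in defect x v](subrK (eval P)) defectD -[X in filt _ X]addrA.
apply: lspanD.
  by apply: filt_mono (filt_defect px fv); rewrite /x partner_index2 //; clear; lia.
have -> : defect x (eval P) = \sum_(s <- msupp P) P@_s *: defect x (word s).
  by rewrite /eval mlinE linear_sum; apply: eq_bigr => s _; rewrite linearZZ.
have -> : eval (mlin (strip b lam) P) = \sum_(s <- msupp P)
    P@_s *: ((lam * (count_mem b s)%:R) *: word (behead s)).
  rewrite [mlin (strip b lam) P]mlinE /eval linear_sum; apply: eq_bigr => s _.
  by rewrite /= mlinZ /strip mlinZ mlinU.
rewrite -sumrB; apply: lspan_sum => s sP; rewrite -scalerBr; apply: lspanZ.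
have [ns <-] := hP s sP.
exact: lead_term nb px Ek s ns (head_all ns (maxb s sP)).
Qed.

(** Induction on the degree of the symbol P, lowered by the partner of its largest
    letter as long as that partner lies in p_epsilon. *)
Lemma vacuum_in (n : nat) D P v : D < n%:Z -> homogeneous D P -> P != 0 ->
  v \in N -> filt (D - 1) (v - eval P) -> w \in N.
Proof.
elim: n D P v => [|n IH] D P v Dn hP P0 vN fv.
  have [s sP] := support_nonempty P0.
  have [/andP[/wdeg_ge0 s0 _] sD] := hP s sP.
  by rewrite sD in s0; have := le_lt_trans s0 Dn; rewrite ltxx.
have [s1 sP max1] : exists2 s, s \in msupp P &
    forall t, t \in msupp P -> rank (head BC t) <= rank (head BC s).
  apply: (@seq_argmax _ (fun s => rank (head BC s)) (msupp P)).
  have [s sP] := support_nonempty P0; apply/eqP => e0.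
  by have : s \in (msupp P : seq _) by []; rewrite e0.
have [ns1 D1] := hP s1 sP; case: s1 => [|b u] in sP max1 ns1 D1.
  (* the empty word has degree 0, hence so has P, and v is a multiple of w *)
  have Pe : P = P@_[::] *: << [::] >>.
    apply: single_support => -[//|j t] /hP [/andP[/andP[nj /wdeg_ge0 nt] _]].
    rewrite -D1 wdeg_cons => E0; have := deg_gt0 nj; clear -E0 nt.
    by rewrite [wdeg [::]]/= in E0; lia.
  have a0 : P@_[::] != 0 by apply: contra P0 => /eqP e0; rewrite Pe e0 scale0r.
  apply: (NZ_inv a0).
  suff <- : v = P@_[::] *: w by [].
  apply/eqP; rewrite -subr_eq0; apply/eqP.
  have := filt_negative _ fv; rewrite {1}Pe /eval mlinZ mlinU; apply.
  by rewrite -D1.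
rewrite [head _ _]/= in max1.
have nb : creation b by case/andP: ns1 => /andP[].
have [px|[eb dh]] := partner_p nb.
  have [kap k0 Ek] := partner_abr nb.
  have fv' := descend hP fv nb px Ek max1.
  apply: IH fv'; last exact: defect_in.
  - by have := deg_gt0 nb; clear -Dn; lia.
  - exact: strip_homogeneous.
  - have l0 : kap * chi (BL d) != 0 by rewrite mulf_neq0.
    apply: (strip_neq0 l0 hP max1).
    by apply/hasP; exists (b :: u) => //; exact: mem_head.
(* b is the smallest letter as well as the largest one *)
have Pe : P = P@_[:: b] *: << [:: b] >>.
  apply: single_support => s /[dup] sP' /hP [ns sD].
  have rs := head_all ns (max1 s sP').
  have ab j : j \in s -> j = b.
    move=> js; apply: (@rank_inj h); apply/eqP; rewrite eq_le (allP rs j js) eb.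
    by apply: min_letter; case/andP: ns => /allP/(_ j js).
  case: s ns ab {sP' rs} sD => [|j [|i t]] ns ab sD.
  - by rewrite /= -D1 wdeg_cons in sD; case/andP: ns1 => /andP[/deg_gt0 ? /wdeg_ge0 ?] _; lia.
  - by rewrite (ab j) ?mem_head.
  move: ns; rewrite (ab j) ?mem_head // (ab i) ?inE ?eqxx ?orbT //.
  by rewrite normal_cons /= precedes_refl eb andbF.
have a0 : P@_[:: b] != 0 by apply: contra P0 => /eqP e0; rewrite Pe e0 scale0r.
have Db : D = deg b.
  have : [:: b] \in msupp P by rewrite -mcoeff_neq0.
  by move=> /hP [_ <-]; rewrite wdeg_cons addr0.
rewrite {1}Pe /eval mlinZ mlinU Db eb in fv; rewrite eb in a0.
apply: (last_letter dh a0 vN _ fv).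
by rewrite ltrBlDr ltrDl.
Qed.

Lemma submodule_vacuum D v : filt D v -> v \in N -> v != 0 -> w \in N.
Proof.
have [n] : exists n : nat, D < n%:Z by exists `|D|.+1; lia.
elim: n D => [|n IH] D Dn fv vN v0.
  by rewrite (filt_negative Dn fv) eqxx in v0.
have [P hP fP] := symbol_exists fv.
have [P0|P0] := eqVneq P 0; last exact: vacuum_in Dn hP P0 vN fP.
move: fP; rewrite P0 /eval mlin0 subr0 => fD.
by apply: (IH (D - 1)) => //; clear -Dn; lia.
Qed.

End Submodule.

Hypothesis w_neq0 : w != 0.
Hypothesis w_cyclic : forall P : M -> Prop, P w ->
  (forall a u v, P u -> P v -> P (a *: u + v)) ->
  (forall x v, P v -> P (action x v)) -> forall v, P v.

Lemma filt_exhaustive v : exists D, filt D v.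
Proof.
move: v; apply: w_cyclic.
- by exists 0; apply: (@filt_word _ [::]).
- move=> a u v [D fu] [E fv]; exists (Num.max D E); apply: lspanP.
    by apply: filt_mono fu; rewrite le_max lexx.
  by apply: filt_mono fv; rewrite le_max lexx orbT.
move=> x v [D fv]; elim/svir_ind: x => [|a x y [E fx] [F fy]|b].
- by exists 0; rewrite -[action _ _]/(actionl v 0) linear0; exact: lspan0.
- exists (Num.max E F); rewrite actionDl actionZl; apply: lspanP.
    by apply: filt_mono fx; rewrite le_max lexx.
  by apply: filt_mono fy; rewrite le_max lexx orbT.
- by exists (D + deg b); exact: filt_act.
Qed.

(** Any nonzero module generated by an even Whittaker vector of this type is
    simple. *)
Theorem whittaker_simple : simple_module M.
Proof.
split; first by exists w.
move=> N gN; have [allz|] := pselect (forall v, v \in N -> v = 0); first by left.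
move=> nz; right; have [v [vN v0]] : exists v, v \in N /\ v != 0.
  apply: contrapT => no; apply: nz => v vN; apply/eqP.
  by apply: contrapT => /negP v0; apply: no; exists v.
have [D fv] := filt_exhaustive v.
have wN := submodule_vacuum gN fv vN v0.
case: gN => -[_ NL] _ NA.
by apply: w_cyclic => // a u u' uN; exact: NL.
Qed.

End WhittakerModule.

(** * The theorem *)

Section WhittakerCase.
Variables (K : numFieldType) (h : bool) (psi : lieHom (pLie K h) (lineLie K)) (c : K).
Local Notation w := (wvec psi c).
Local Notation chi := (wchar psi c).
Local Notation e b := (<< b >> : svir K h).

Lemma wvec_char b : ~~ creation h b -> action (e b) w = chi b *: w.
Proof.
have inclE (x : pLie K h) (a : lineLie K) :
    action (val x + (a : K) *: svirC K h) w = (psi x + (a : K) * c : K) *: w.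
  exact: (cyclic_vector_char (pc_inclusion K h) (pc_character psi c) (x, a)).
move=> /creation_spec[pb|->].
  have := inclE (Sub (e b) (p_mem_basis K pb)) 0.
  rewrite scale0r addr0 mul0r addr0 => ->; congr (_ *: _).
  by rewrite -psi_extE; case: b pb.
have := inclE 0 1; rewrite scale1r mul1r (linear0 psi) !add0r => <-.
by [].
Qed.

Theorem Wmodule_simple (d : int) : 1 <= d <= 2 -> 2 <= d + h%:Z ->
  (forall n : int, d < n -> psib psi (BL n) = 0) -> psib psi (BL d) != 0 ->
  simple_module (Wmodule psi c).
Proof.
move=> d12 dh high nz.
apply: (@whittaker_simple K h (Wmodule psi c) w chi d d12 dh) => //.
- exact: wchar_odd.
- exact: wvec_char.
- exact: cyclic_vector_even.
- exact: wvec_neq0.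
- exact: cyclic_vector_ind.
Qed.

End WhittakerCase.

Local Open Scope complex_scope.

Theorem theorem4p8 (R : realType) (h : bool) (c : R[i])
    (psi : lieHom (pLie R[i] h) (lineLie R[i]))
    (psi_neq0 : exists x : pLie R[i] h, psi x != 0) :
  (epsilon R[i] h = 1 / 2 -> simple_module (Wmodule psi c)) /\
  (epsilon R[i] h = 0 ->
     (simple_module (Wmodule psi c) <-> psi (pL2 R[i] h) != 0)).
Proof.
have e2 : psi (pL2 R[i] h) = psib psi (BL 2) by rewrite /pL2 psib_pL.
have simple2 : psib psi (BL 2) != 0 -> simple_module (Wmodule psi c).
  by move=> n2; apply: (@Wmodule_simple _ _ _ _ 2) => //; exact: psib_high.
split=> [eps|eps].
- have hT : h = true.
    case: h eps {psi psi_neq0 e2 simple2} => // /eqP.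
    by rewrite /epsilon mul0r mul1r eq_sym invr_eq0 pnatr_eq0.
  have [p2|n2] := eqVneq (psib psi (BL 2)) 0; last exact: simple2.
  apply: (@Wmodule_simple _ _ _ _ 1) => //; first by rewrite hT.
    move=> n n1; have [->//|n2] := eqVneq n 2.
    by apply: psib_high; lia.
  by case: (psi_nonzero psi_neq0) => //; rewrite p2 eqxx.
- have hF : h = false.
    case: h eps {psi psi_neq0 e2 simple2} => // /eqP.
    by rewrite /epsilon mul1r invr_eq0 pnatr_eq0.
  rewrite e2; split=> // simpleW; apply/eqP => p2.
  exact: (not_simple hF p2 simpleW).
Qed.
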